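(* The following problem is decidable: given a rational relation $R\subseteq\Sigma^*\times\Gamma^*$, decide whether $R$ has a uniformization by a recognizable relation, i.e. whether there is a function $g:\mathrm{dom}(R)\to\Gamma^*$ with $(u,g(u))\in R$ for all $u\in\mathrm{dom}(R)$ whose graph $\{(u,g(u)):u\in\mathrm{dom}(R)\}$ is a recognizable relation.
   Context: $\Sigma,\Gamma$ are disjoint finite alphabets. For $w\in(\Sigma\cup\Gamma)^*$, $\llbracket w\rrbracket=(\pi_{\mathtt i}(w),\pi_{\mathtt o}(w))$ where $\pi_{\mathtt i}$ (resp. $\pi_{\mathtt o}$) deletes all letters of $\Gamma$ (resp. $\Sigma$). A relation is rational if it equals $\{\llbracket w\rrbracket:w\in S\}$ for some regular $S\subseteq(\Sigma\cup\Gamma)^*$ (it is given by such an $S$, e.g. via an NFA). A relation is recognizable if it is a finite union of products $U\times V$ with $U\subseteq\Sigma^*$, $V\subseteq\Gamma^*$ regular. *)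

(* Defs.v *)
From mathcomp Require Import all_boot.
Set Implicit Arguments. Unset Strict Implicit. Unset Printing Implicit Defensive.

Inductive recf : Type :=
| RZero
| RSucc
| RProj (i : nat)
| RComp (f : recf) (gs : list recf)
| RPrec (f g : recf)
| RMu (f : recf).

Inductive eval : recf -> seq nat -> nat -> Prop :=
| eZero xs : eval RZero xs 0
| eSucc xs : eval RSucc xs (head 0 xs).+1
| eProj i xs : eval (RProj i) xs (nth 0 xs i)
| eComp f gs xs ys v : evals gs xs ys -> eval f ys v -> eval (RComp f gs) xs v
| ePrec0 f g xs v : eval f xs v -> eval (RPrec f g) (0 :: xs) v
| ePrecS f g n xs r v :
    eval (RPrec f g) (n :: xs) r -> eval g (n :: r :: xs) v ->
    eval (RPrec f g) (n.+1 :: xs) v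
| eMu f xs n :
    eval f (n :: xs) 0 ->
    (forall m, m < n -> exists k, eval f (m :: xs) k.+1) ->
    eval (RMu f) xs n
with evals : list recf -> seq nat -> seq nat -> Prop :=
| esNil xs : evals nil xs [::]
| esCons g gs xs y ys : eval g xs y -> evals gs xs ys -> evals (g :: gs) xs (y :: ys).

(* A predicate on a countable type of (finite, computably encoded) instances is
   decidable if a mu-recursive function computes its characteristic function on
   the (computable) encoding [pickle]. *)
Definition decidable_pred (T : countType) (P : T -> Prop) : Prop :=
  exists f : recf, forall x : T,
    (P x -> eval f [:: pickle x] 1) /\ (~ P x -> eval f [:: pickle x] 0).

Definition nfa (A : Type) : Type := (seq (nat * A * nat) * seq nat * seq nat)%type.

Definition nfa_trans {A : Type} (N : nfa A) := N.1.1.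
Definition nfa_init {A : Type} (N : nfa A) := N.1.2.
Definition nfa_final {A : Type} (N : nfa A) := N.2.

Definition nfa_accepts {A : eqType} (N : nfa A) (w : seq A) : Prop :=
  exists (q : nat) (qs : seq nat),
    [/\ q \in nfa_init N, last q qs \in nfa_final N, size qs = size w &
        all (fun t => t \in nfa_trans N) (zip (zip (belast q qs) w) qs)].

Definition regular {A : eqType} (L : seq A -> Prop) : Prop :=
  exists N : nfa A, forall w, L w <-> nfa_accepts N w.

Definition proj_i {S G : Type} (w : seq (S + G)) : seq S :=
  pmap (fun x => if x is inl a then Some a else None) w.
Definition proj_o {S G : Type} (w : seq (S + G)) : seq G :=
  pmap (fun x => if x is inr b then Some b else None) w.

Definition rat_rel {S G : eqType} (N : nfa (S + G)) (u : seq S) (v : seq G) : Prop :=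
  exists w, [/\ nfa_accepts N w, proj_i w = u & proj_o w = v].

Definition recognizable {S G : eqType} (R : seq S -> seq G -> Prop) : Prop :=
  exists (n : nat) (U : nat -> seq S -> Prop) (V : nat -> seq G -> Prop),
    (forall i, i < n -> regular (U i) /\ regular (V i)) /\
    (forall u v, R u v <-> exists2 i, i < n & U i u /\ V i v).

Definition dom {S G : Type} (R : seq S -> seq G -> Prop) (u : seq S) : Prop :=
  exists v, R u v.

Definition has_rec_uniformization {S G : eqType} (R : seq S -> seq G -> Prop) : Prop :=
  exists g : seq S -> seq G,
    (forall u, dom R u -> R u (g u)) /\
    recognizable (fun u v => dom R u /\ v = g u).

(* Main.v *)
(** A recognizable graph of a function has finite image, so [R] is uniformizable
    by a recognizable relation iff it is limited: some [K] bounds, for every [u]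
    in the domain, the length of a shortest output.  Counting output letters as
    the cost of a run, this is the limitedness problem for distance automata,
    solved as by Hashiguchi, Leung and Simon.  An input word is abstracted by the
    three relations "cost 0", "bounded cost", "finite cost" on states; an
    idempotent [(Z, B, R)] may be iterated, giving
    [(Z, B (Z inter diagonal) B, R)].  The automaton is limited iff some set of
    triples contains the triples of the letters, is closed under product and
    iteration, and has no accepting pair of finite cost in a triple without an
    accepting pair of bounded cost.  Necessity holds because the triples
    [(Z, B, R)] such that, for every [n], some word has zero-cost relation [Z],
    finite-cost relation [R] and all its pairs of cost at most [n] in [B] form
    such a set; sufficiency because every word can be evaluated in such a set by
    a tree of bounded height (factorization forests).  Sets of triples are finite
    objects of bounded size, so the criterion is a bounded-quantifier formula in
    the code of the automaton, and hence computable. *)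

From HB Require Import structures.
Require Import Defs.
From mathcomp Require Import all_boot.
From mathcomp Require Import boolp zify.
Set Implicit Arguments. Unset Strict Implicit. Unset Printing Implicit Defensive.

(** * Computability of bounded formulas *)

Definition computable k (F : seq nat -> nat) : Prop :=
  exists f, forall xs, size xs = k -> eval f xs (F xs).

(** The truth value is the classical one; what is demanded is a program for this characteristic
    function. *)
Definition computable_pred k (P : seq nat -> Prop) : Prop :=
  computable k (fun xs => nat_of_bool `[< P xs >]).

Lemma eq_computable k F G :
  (forall xs, size xs = k -> F xs = G xs) -> computable k F -> computable k G.
Proof.
by move=> eFG [f Hf]; exists f => xs sz; rewrite -eFG //; apply: Hf.
Qed.

Lemma eq_computable_pred k P Q :
    (forall xs, size xs = k -> P xs <-> Q xs) ->
  computable_pred k P -> computable_pred k Q.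
Proof.
move=> ePQ; apply: eq_computable => xs sz; congr nat_of_bool.
exact/asbool_equiv_eq/ePQ.
Qed.

Fixpoint computables k (Fs : seq (seq nat -> nat)) : Prop :=
  if Fs is F :: Fs' then computable k F /\ computables k Fs' else True.

Lemma computables_evals k Fs : computables k Fs ->
  exists gs, forall xs, size xs = k -> evals gs xs [seq F xs | F <- Fs].
Proof.
elim: Fs => [|F Fs IH] /=; first by exists nil => xs _; constructor.
by case=> [[f Hf] /IH[gs Hgs]]; exists (f :: gs) => xs sz; constructor; auto.
Qed.

Lemma computable_comp m k G Fs : computable m G -> computables k Fs ->
  size Fs = m -> computable k (fun xs => G [seq F xs | F <- Fs]).
Proof.
move=> [g Hg] /computables_evals[fs Hfs] szm; exists (RComp g fs) => xs sz.
by apply: eComp (Hfs xs sz) _; apply: Hg; rewrite size_map.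
Qed.

Lemma computable_nth k i : computable k (fun xs => nth 0 xs i).
Proof. by exists (RProj i) => xs _; constructor. Qed.

(** A variable bound outside several quantifiers shows up as an entry of an iterated [behead], a
    projection only up to the equation required here. *)
Lemma computable_var k v i : (forall xs, v xs = nth 0 xs i) -> computable k v.
Proof. by move=> e; apply: eq_computable (computable_nth k i). Qed.

Definition projections k : seq (seq nat -> nat) :=
  [seq (fun xs => nth 0 xs i) | i <- iota 0 k].

Lemma computables_projections k : computables k (projections k).
Proof.
rewrite /projections; elim: (iota 0 k) => //= i s IH; split=> //.
exact: computable_nth.
Qed.

Lemma map_projections k xs : size xs = k -> [seq F xs | F <- projections k] = xs.
Proof. by move=> <-; rewrite -map_comp; exact: mkseq_nth. Qed.

Lemma size_projections k : size (projections k) = k.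
Proof. by rewrite size_map size_iota. Qed.

Lemma computable_behead k F : computable k F -> computable k.+1 (F \o behead).
Proof.
move=> cF; pose Ps := behead (projections k.+1).
have cP : computables k.+1 Ps.
  by case: (computables_projections k.+1).
apply: eq_computable (computable_comp cF cP _) => [xs sz /=|]; last first.
  by rewrite size_behead size_projections.
by rewrite -behead_map map_projections.
Qed.

Lemma computable_prec k F G : computable k F -> computable k.+2 G ->
  computable k.+1 (fun xs =>
    iteri (head 0 xs) (fun i r => G [:: i, r & behead xs]) (F (behead xs))).
Proof.
move=> [f Hf] [g Hg]; exists (RPrec f g) => -[//|n xs] /= [sz].
elim: n => [|n IHn] /=; first by constructor; apply: Hf.
by apply: ePrecS IHn _; apply: Hg => /=; rewrite sz.
Qed.

(** Passing all projections next to [N] to the primitive recursion keeps the parameters available to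
    its step. *)
Lemma computable_iteri k N F G :
    computable k N -> computable k F -> computable k.+2 G ->
  computable k (fun xs => iteri (N xs) (fun i r => G [:: i, r & xs]) (F xs)).
Proof.
move=> cN cF cG.
have cNs : computables k (N :: projections k).
  by split=> //; apply: computables_projections.
apply: eq_computable (computable_comp (computable_prec cF cG) cNs _) => /=.
  by move=> xs sz; rewrite map_projections.
by rewrite size_projections.
Qed.

Lemma computable_succ k F : computable k F -> computable k (fun xs => (F xs).+1).
Proof.
move=> cF; have cs : computable 1 (fun xs => (head 0 xs).+1).
  by exists RSucc => xs _; constructor.
have cFs : computables k [:: F] by [].
exact: eq_computable (computable_comp cs cFs _).
Qed.

Lemma computable_const k c : computable k (fun=> c).
Proof.
elim: c => [|c IHc]; last exact: computable_succ.
by exists RZero => xs _; constructor.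
Qed.

Lemma computable_add k F G : computable k F -> computable k G ->
  computable k (fun xs => F xs + G xs).
Proof.
move=> cF cG; apply: eq_computable (computable_iteri cF cG
  (computable_succ (computable_nth k.+2 1))) => xs _ /=.
by elim: (F xs) => //= n ->; rewrite addSn.
Qed.

Lemma computable_mul k F G : computable k F -> computable k G ->
  computable k (fun xs => F xs * G xs).
Proof.
move=> cF cG; apply: eq_computable (computable_iteri cF (computable_const k 0)
  (computable_add (computable_behead (computable_behead cG))
    (computable_nth k.+2 1))) => xs _ /=.
by elim: (F xs) => //= n ->; rewrite mulSn.
Qed.

Lemma computable_exp2 k F : computable k F -> computable k (fun xs => 2 ^ F xs).
Proof.
move=> cF; apply: eq_computable (computable_iteri cF (computable_const k 1)
  (computable_add (computable_nth k.+2 1) (computable_nth k.+2 1))) => xs _ /=.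
by elim: (F xs) => //= n ->; rewrite expnS mul2n addnn.
Qed.

Lemma computable_sub k F G : computable k F -> computable k G ->
  computable k (fun xs => F xs - G xs).
Proof.
move=> cF cG.
have cpred : computable k.+2 (fun xs => (nth 0 xs 1).-1).
  (* The predecessor is a recursion whose step returns the counter and forgets the accumulator. *)
  apply: eq_computable (computable_iteri (computable_nth k.+2 1)
    (computable_const _ 0) (computable_nth k.+4 0)) => xs _ /=.
  by case: (nth 0 xs 1).
apply: eq_computable (computable_iteri cG cF cpred) => xs _ /=.
by elim: (G xs) => [|n /= ->]; rewrite ?subn0 ?subnS.
Qed.

Lemma computable_pred_le k F G : computable k F -> computable k G ->
  computable_pred k (fun xs => F xs <= G xs).
Proof.
move=> cF cG; apply: eq_computable
  (computable_sub (computable_const k 1) (computable_sub cF cG)) => xs _.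
by rewrite asboolb -subn_eq0; case: (F xs - G xs).
Qed.

Lemma computable_pred_and k P Q : computable_pred k P -> computable_pred k Q ->
  computable_pred k (fun xs => P xs /\ Q xs).
Proof.
move=> cP cQ; apply: eq_computable (computable_mul cP cQ) => xs _.
by rewrite asbool_and mulnb.
Qed.

Lemma computable_pred_not k P : computable_pred k P ->
  computable_pred k (fun xs => ~ P xs).
Proof.
move=> cP; apply: eq_computable (computable_sub (computable_const k 1) cP).
by move=> xs _; rewrite asbool_neg; case: asbool.
Qed.

Lemma computable_pred_or k P Q : computable_pred k P -> computable_pred k Q ->
  computable_pred k (fun xs => P xs \/ Q xs).
Proof.
move=> cP cQ; apply: eq_computable_pred (computable_pred_not
  (computable_pred_and (computable_pred_not cP) (computable_pred_not cQ))).
by move=> xs _; have := EM (P xs); have := EM (Q xs); tauto.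
Qed.

Lemma computable_pred_imp k P Q : computable_pred k P -> computable_pred k Q ->
  computable_pred k (fun xs => P xs -> Q xs).
Proof.
move=> cP cQ; apply: eq_computable_pred
  (computable_pred_or (computable_pred_not cP) cQ).
by move=> xs _; have := EM (P xs); tauto.
Qed.

Lemma computable_pred_iff k P Q : computable_pred k P -> computable_pred k Q ->
  computable_pred k (fun xs => P xs <-> Q xs).
Proof.
by move=> cP cQ; apply: computable_pred_and; apply: computable_pred_imp.
Qed.

Lemma computable_pred_eq k F G : computable k F -> computable k G ->
  computable_pred k (fun xs => F xs = G xs).
Proof.
move=> cF cG; apply: eq_computable_pred (computable_pred_and
  (computable_pred_le cF cG) (computable_pred_le cG cF)) => xs _.
by split=> [[le1 le2]|->//]; apply/eqP; rewrite eqn_leq le1.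
Qed.

(** The quantifiers are named so that [computable_step] recognizes them by their head symbol. *)
Definition bforall B (P : nat -> Prop) := forall i, i < B -> P i.
Definition bexists B (P : nat -> Prop) := exists i, i < B /\ P i.
Definition fforall (T : finType) (P : T -> Prop) := forall t, P t.
Definition fexists (T : finType) (P : T -> Prop) := exists t, P t.

Lemma computable_pred_bforall k B P : computable k B ->
    computable_pred k.+1 (fun ys => P (behead ys) (nth 0 ys 0)) ->
  computable_pred k (fun xs => bforall (B xs) (P xs)).
Proof.
move=> cB cP.
(* The iteration multiplies truth values. Its step receives the index, the accumulator and the
   parameters; [P] gets these without the accumulator. *)
pose G ys := nth 0 ys 1 * `[< P (behead (behead ys)) (nth 0 ys 0) >].
have cG : computable k.+2 G.
  apply: computable_mul; first exact: computable_nth.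
  pose Ps := behead (behead (projections k.+2)).
  have cFs : computables k.+2 ((fun ys => nth 0 ys 0) :: Ps).
    split; first exact: computable_nth.
    by have [_ []] := computables_projections k.+2.
  apply: eq_computable (computable_comp cP cFs _) => [ys sz /=|].
    by rewrite -!behead_map map_projections.
  by rewrite /= !size_behead size_projections.
apply: eq_computable (computable_iteri cB (computable_const k 1) cG) => xs _.
rewrite /G /=; elim: (B xs) => [|n IHn] /=; first by rewrite asboolT.
rewrite IHn mulnb; congr nat_of_bool.
apply/andP/asboolP=> [[/asboolP Pn /asboolP P0] i|Pn].
  by rewrite ltnS leq_eqVlt => /predU1P[->|/Pn].
by split; apply/asboolP; [move=> i lt_i; apply: Pn (ltnW _) | apply: Pn].
Qed.

Lemma computable_pred_bexists k B P : computable k B ->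
    computable_pred k.+1 (fun ys => P (behead ys) (nth 0 ys 0)) ->
  computable_pred k (fun xs => bexists (B xs) (P xs)).
Proof.
move=> cB cP; apply: eq_computable_pred (computable_pred_not
  (computable_pred_bforall (P := fun xs i => ~ P xs i) cB
    (computable_pred_not cP))) => xs _; split=> [nP|[i [lti Pi]] nP].
  by apply: contra_notP nP => nP i lti Pi; apply: nP; exists i.
exact: nP Pi.
Qed.

(** The type does not depend on the input, so this is a finite conjunction built along [enum T],
    with one program per element. *)
Lemma computable_pred_fforall k (T : finType) (P : seq nat -> T -> Prop) :
    (forall t, computable_pred k (P^~ t)) ->
  computable_pred k (fun xs => fforall (P xs)).
Proof.
move=> cP.
have {cP}: computable_pred k (fun xs => forall t, t \in enum T -> P xs t).
  elim: (enum T) => [|t s IHs].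
    by apply: eq_computable_pred (computable_pred_eq (computable_const k 0)
      (computable_const k 0)).
  apply: eq_computable_pred (computable_pred_and (cP t) IHs) => xs _.
  split=> [[Pt Ps] u|Ps]; first by rewrite inE => /predU1P[->|/Ps].
  by split=> [|u us]; apply: Ps; rewrite inE ?eqxx // us orbT.
apply: eq_computable_pred => xs _; split=> Ps t; last by move=> _; apply: Ps.
by apply: Ps; rewrite mem_enum.
Qed.

Lemma computable_pred_fexists k (T : finType) (P : seq nat -> T -> Prop) :
    (forall t, computable_pred k (P^~ t)) ->
  computable_pred k (fun xs => fexists (P xs)).
Proof.
move=> cP; apply: eq_computable_pred (computable_pred_not
  (computable_pred_fforall (fun t => computable_pred_not (cP t)))) => xs _.
split=> [nP|[t Pt] nP]; last exact: nP Pt.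
by apply: contra_notP nP => nP t Pt; apply: nP; exists t.
Qed.

(** * Evaluation of words in a finite monoid *)

Section FiniteMonoid.

Variables (S : finType) (one : S) (mul : Monoid.law one).
Local Notation "x ** y" := (mul x y) (at level 40, left associativity).

Let mulA x y z : x ** (y ** z) = x ** y ** z. Proof. exact: Monoid.mulmA. Qed.
Let mul1 x : one ** x = x. Proof. exact: Monoid.mul1m. Qed.
Let mulr1 x : x ** one = x. Proof. exact: Monoid.mulm1. Qed.

(** * Two-sided principal ideals and their sizes *)

Definition ideal (s : S) : {set S} := [set x.1 ** s ** x.2 | x : S * S].
Definition rank (s : S) : nat := #|ideal s|.

Lemma mem_ideal x s y : x ** s ** y \in ideal s.
Proof. by apply/imsetP; exists (x, y). Qed.

Lemma ideal_id s : s \in ideal s.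
Proof. by rewrite -{1}[s]mul1 -[X in X \in _]mulr1 mem_ideal. Qed.

Lemma ideal_mul x s y : ideal (x ** s ** y) \subset ideal s.
Proof.
apply/subsetP=> _ /imsetP[[a b] _ ->] /=.
by rewrite !mulA -(mulA _ y) mem_ideal.
Qed.

Lemma rank_mull x s : rank (x ** s) <= rank s.
Proof. by rewrite -[x ** s]mulr1; apply/subset_leq_card/ideal_mul. Qed.

Lemma rank_mulr s y : rank (s ** y) <= rank s.
Proof. by rewrite -{1}[s]mul1; apply/subset_leq_card/ideal_mul. Qed.

(* Right multiplication by [b] maps [S p] onto [S p b], so [y = a p b] gives
   [#|S y| <= #|S p|], while [p = p y] gives [S p \subset S y]. *)
Lemma fixed_factorl p y : p ** y = p -> rank y <= rank p -> exists z, y = z ** p.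
Proof.
move=> pyp le_rank; pose L s := [set x ** s | x : S].
have sIpy : ideal p \subset ideal y.
  by rewrite -{1}pyp -[p ** y]mulr1 ideal_mul.
have /imsetP[[a b] _ /= def_y] : y \in ideal p.
  have /eqP-> : ideal p == ideal y by rewrite eqEcard sIpy.
  exact: ideal_id.
have sLpy : L p \subset L y.
  apply/subsetP=> _ /imsetP[x _ ->]; apply/imsetP; exists (x ** p) => //.
  by rewrite -mulA pyp.
have leL : #|L y| <= #|L p|.
  apply: leq_trans (leq_imset_card (mul^~ b) _); apply/subset_leq_card.
  apply/subsetP=> _ /imsetP[x _ ->]; apply/imsetP; exists (x ** a ** p).
    by apply/imsetP; exists (x ** a).
  by rewrite def_y !mulA.
have /eqP eL : L p == L y by rewrite eqEcard sLpy.
have /imsetP[z _ ->] : y \in L p; last by exists z.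
by rewrite eL; apply/imsetP; exists one => //; rewrite mul1.
Qed.

Lemma fixed_factorr q y : y ** q = q -> rank y <= rank q -> exists z, y = q ** z.
Proof.
move=> yqq le_rank; pose L s := [set s ** x | x : S].
have sIqy : ideal q \subset ideal y.
  by rewrite -{1}yqq -{1}[y]mul1 ideal_mul.
have /imsetP[[a b] _ /= def_y] : y \in ideal q.
  have /eqP-> : ideal q == ideal y by rewrite eqEcard sIqy.
  exact: ideal_id.
have sLqy : L q \subset L y.
  apply/subsetP=> _ /imsetP[x _ ->]; apply/imsetP; exists (q ** x) => //.
  by rewrite mulA yqq.
have leL : #|L y| <= #|L q|.
  apply: leq_trans (leq_imset_card (mul a) _); apply/subset_leq_card.
  apply/subsetP=> _ /imsetP[x _ ->]; apply/imsetP; exists (q ** (b ** x)).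
    by apply/imsetP; exists (b ** x).
  by rewrite def_y !mulA.
have /eqP eL : L q == L y by rewrite eqEcard sLqy.
have /imsetP[z _ ->] : y \in L q; last by exists z.
by rewrite eL; apply/imsetP; exists one => //; rewrite mulr1.
Qed.

(** If the rank does not drop, [fixed_factorl] gives [e = z ** f], hence [e ** f = e], while
    [e ** f = f]. *)
Lemma idempotent_below e f : e ** f = f -> f ** e = f -> f ** f = f ->
  f = e \/ rank f < rank e.
Proof.
move=> ef fe ff; have [?|le_rank] := ltnP (rank f) (rank e); first by right.
left; have [z def_e] := fixed_factorl fe le_rank.
by rewrite -ef def_e -mulA ff.
Qed.

(** Here [y = z ** p] and [y' = q ** z'], so [y ** y'] equals [y] because [y'] fixes [p], and equals
    [y'] because [y] fixes [q]. The case [y' = y] yields idempotency. *)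
Lemma fixed_pair_unique p q y y' :
    p ** y = p -> y ** q = q -> p ** y' = p -> y' ** q = q ->
    rank y <= rank p -> rank y' <= rank q ->
  y ** y' = y /\ y = y'.
Proof.
move=> py yq py' y'q le_p le_q.
have [z def_y] := fixed_factorl py le_p.
have [z' def_y'] := fixed_factorr y'q le_q.
have e1 : y ** y' = y by rewrite {1}def_y -mulA py'.
by split=> //; rewrite -{1}e1 {1}def_y' mulA yq.
Qed.

(** * Evaluation with bounded constants, after Simon's factorization forests *)

Section Evaluation.

(** [P K w s] stands for: [w] evaluates to [s] with constant [K]. Products add constants, but by
    [P_sharp] an iteration has a constant independent of the number of factors. [sharp_ax] puts
    [sharp e] below [e], so that it is [e] or has smaller rank. *)
Variables (A : eqType) (P : nat -> seq A -> S -> Prop) (sharp : S -> S).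
Hypothesis P_le : forall K L w s, K <= L -> P K w s -> P L w s.
Hypothesis P_mul : forall K L w v s t,
  P K w s -> P L v t -> P (K + L) (w ++ v) (s ** t).
Hypothesis P_sharp : forall K (ws : seq (seq A)) e, e ** e = e -> ws != [::] ->
  {in ws, forall w, P K w e} -> P (K + K) (flatten ws) (sharp e).
Hypothesis sharp_ax : forall K w e, P K w e -> e ** e = e ->
  [/\ e ** sharp e = sharp e, sharp e ** e = sharp e
    & sharp e ** sharp e = sharp e].

Definition small r K w := exists2 s, P K w s & rank s < r.
Definition exact_or_small r K w s := P K w s \/ small r K w.

Lemma small_le r K L w : K <= L -> small r K w -> small r L w.
Proof. by move=> le [s Ps lts]; exists s => //; apply: P_le Ps. Qed.

Lemma small_catl r K L w v t : small r K w -> P L v t -> small r (K + L) (w ++ v).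
Proof.
move=> [s Ps lts] Pt; exists (s ** t); first exact: P_mul.
exact: leq_ltn_trans (rank_mulr _ _) lts.
Qed.

Lemma small_catr r K L w v s : P K w s -> small r L v -> small r (K + L) (w ++ v).
Proof.
move=> Ps [t Pt ltt]; exists (s ** t); first exact: P_mul.
exact: leq_ltn_trans (rank_mull _ _) ltt.
Qed.

Lemma exact_or_small_cat r K L w v s t :
    exact_or_small r K w s -> exact_or_small r L v t ->
  exact_or_small r (K + L) (w ++ v) (s ** t).
Proof.
move=> [Ps|sw] [Pt|sv]; first by left; apply: P_mul.
- by right; apply: small_catr Ps sv.
- by right; apply: small_catl sw Pt.
by right; case: sv => t' Pt' _; apply: small_catl sw Pt'.
Qed.

(** The statement proved by induction on the rank; the point is that [F K] does not depend on the
    number of words. *)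
Definition smalls_bounded r := exists F, forall K (ws : seq (seq A)), ws != [::] ->
  {in ws, forall w, small r K w} -> small r (F K) (flatten ws).

(** Scan [l] from the left and extend the current block while [G] holds. When [G] fails, the block
    is small and is cut off. The blocks cut off form a small word by [HF], and the last, unfinished
    block [L] still satisfies [G]. *)
Lemma greedy_small r F (X : eqType) (wd : X -> seq A) (G : seq X -> Prop) K l :
    (forall K (ws : seq (seq A)), ws != [::] ->
       {in ws, forall w, small r K w} -> small r (F K) (flatten ws)) ->
    (forall L x, x \in l -> G L ->
       G (rcons L x) \/ small r K (flatten (map wd (rcons L x)))) ->
    G [::] ->
  exists w L, [/\ flatten (map wd l) = w ++ flatten (map wd L), G L,
    {subset L <= l} & (w = [::] /\ l = L) \/ small r (F K) w].
Proof.
move=> HF HG G0.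
have: exists ws L, [/\ flatten (map wd l) = flatten ws ++ flatten (map wd L),
   G L, {subset L <= l}, ws = [::] -> l = L & {in ws, forall w, small r K w}].
  elim/last_ind: l HG => [|l x IHl] HG; first by exists [::], [::]; split.
  have [|ws [L [def_l GL sLl eL sws]]] := IHl.
    by move=> L y yl; apply: HG; rewrite mem_rcons inE yl orbT.
  have xl : x \in rcons l x by rewrite mem_rcons mem_head.
  have [GLx|sLx] := HG L x xl GL.
    exists ws, (rcons L x); split=> //.
    - by rewrite !map_rcons !flatten_rcons def_l catA.
    - move=> y; rewrite !mem_rcons !inE => /predU1P[->|/sLl->].
        by rewrite eqxx.
      by rewrite orbT.
    by move=> /eL ->.
  exists (rcons ws (flatten (map wd (rcons L x)))), [::]; split=> //.
  - by rewrite !map_rcons !flatten_rcons def_l cats0 catA.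
  - by case: (ws).
  by move=> w; rewrite mem_rcons inE => /predU1P[->|/sws].
case=> ws [L [def_l GL sLl eL sws]]; exists (flatten ws), L; split=> //.
case: eqP (HF K ws) => [ws0 _|_ /(_ isT sws)]; last by right.
by left; rewrite ws0 (eL ws0).
Qed.

(** An item is a word together with a value chosen for it. *)
Definition word (l : seq (seq A * S)) := flatten (map fst l).
Definition value (l : seq (seq A * S)) := \big[mul/one]_(x <- l) x.2.

Lemma word_cat l1 l2 : word (l1 ++ l2) = word l1 ++ word l2.
Proof. by rewrite /word map_cat flatten_cat. Qed.

Lemma value_cat l1 l2 : value (l1 ++ l2) = value l1 ** value l2.
Proof. exact: big_cat. Qed.

Lemma value1 x : value [:: x] = x.2.
Proof. exact: big_seq1. Qed.

Lemma word1 x : word [:: x] = x.1.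
Proof. exact: cats0. Qed.

Definition items r K (l : seq (seq A * S)) :=
  forall x, x \in l -> P K x.1 x.2 /\ rank x.2 <= r.

Lemma rank_value r K l : items r K l -> l != [::] -> rank (value l) <= r.
Proof.
case: l => // x l il _; rewrite -cat1s value_cat value1.
apply: leq_trans (rank_mulr _ _) _.
by have [] := il x (mem_head _ _).
Qed.

(* A cut [l = u ++ v] of a word read between [p] and [q] is coloured by the
   products of everything before and of everything after it. *)
Definition cuts_in p q l (C : {set S * S}) := forall u v,
  u != [::] -> v != [::] -> l = u ++ v -> (p ** value u, value v ** q) \in C.

Lemma cuts_in_infix p q x l y C : cuts_in p q (x ++ l ++ y) C ->
  cuts_in (p ** value x) (value y ** q) l C.
Proof.
move=> cC u v u0 v0 def_l.
rewrite -mulA (mulA (value v)) -!value_cat.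
apply: cC; last by rewrite def_l !catA.
  by case: (x) (u) u0 => [|? ?] [].
by case: (v) v0.
Qed.

Lemma cuts_in_or p q l C c : cuts_in p q l C ->
  cuts_in p q l (C :\ c) \/
  exists u v, [/\ u != [::], v != [::], l = u ++ v
                & (p ** value u, value v ** q) = c].
Proof.
move=> cC; have [cD|ncD] := EM (cuts_in p q l (C :\ c)); first by left.
right; apply: contra_notP ncD => nex u v u0 v0 def_l.
rewrite !inE cC // andbT; apply/eqP=> ec; apply: nex; exists u, v; split=> //.
Qed.

(** Moving the cut to the right as long as the colour [c] recurs ends at a cut after which [c] no
    longer occurs. *)
Lemma last_cut p q l C c u v : cuts_in p q l C ->
    u != [::] -> v != [::] -> l = u ++ v ->
    (p ** value u, value v ** q) = c ->
  exists u' v', [/\ l = u ++ u' ++ v', v' != [::],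
    (p ** value (u ++ u'), value v' ** q) = c &
    cuts_in (p ** value (u ++ u')) q v' (C :\ c)].
Proof.
move=> cC u0; have [n] := ubnP (size v).
elim: n u v u0 => // n IHn u v u0 lt_v v0 def_l ec.
have cv : cuts_in (p ** value u) q v C.
  have := @cuts_in_infix p q u v [::] C; rewrite cats0 -def_l => /(_ cC).
  by rewrite [value [::]]big_nil mul1.
have [cv'|[v1 [v2 [v10 v20 def_v ec']]]] := cuts_in_or c cv.
  by exists [::], v; rewrite !cats0; split.
have [|||||u' [v' [def_l' v'0 ec'' cv']]] := IHn (u ++ v1) v2.
- by case: (u) u0.
- rewrite ltnS in lt_v; apply: leq_trans lt_v.
  by rewrite def_v size_cat -add1n leq_add2r lt0n size_eq0.
- by [].
- by rewrite def_l def_v catA.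
- by rewrite value_cat mulA.
by exists (v1 ++ u'), v'; rewrite !catA in def_l' ec'' cv' *; split.
Qed.

(** Cut wherever the colour is [(p, q)]: both halves fix [p] and [q] again, and a block that cannot
    be cut further has lost this colour. *)
Lemma fixed_blocks p q m C : m != [::] -> p ** value m = p -> value m ** q = q ->
    cuts_in p q m C ->
  exists bs, flatten bs = m /\ forall b, b \in bs ->
    [/\ b != [::], p ** value b = p, value b ** q = q,
        cuts_in p q b (C :\ (p, q)) & {subset b <= m}].
Proof.
have [n] := ubnP (size m); elim: n m => // n IHn m lt_m m0 pm mq cm.
have [cm'|[u [v [u0 v0 def_m [pu vq]]]]] := cuts_in_or (p, q) cm.
  by exists [:: m]; split=> [|b]; [exact: cats0|rewrite inE => /eqP->; split].
have uq : value u ** q = q by rewrite -{1}vq mulA -value_cat -def_m.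
have pv : p ** value v = p by rewrite -{1}pu -mulA -value_cat -def_m.
have cu : cuts_in p q u C.
  have := @cuts_in_infix p q [::] u v C; rewrite -def_m => /(_ cm).
  by rewrite [value [::]]big_nil mulr1 vq.
have cv : cuts_in p q v C.
  have := @cuts_in_infix p q u v [::] C; rewrite cats0 -def_m => /(_ cm).
  by rewrite [value [::]]big_nil mul1 pu.
rewrite ltnS def_m size_cat in lt_m.
have ltu : size u < n.
  by apply: leq_trans lt_m; rewrite -addn1 leq_add2l lt0n size_eq0.
have ltv : size v < n.
  by apply: leq_trans lt_m; rewrite -add1n leq_add2r lt0n size_eq0.
have [bs [def_u Hbs]] := IHn u ltu u0 pu uq cu.
have [cs [def_v Hcs]] := IHn v ltv v0 pv vq cv.
exists (bs ++ cs); rewrite flatten_cat def_u def_v; split=> // b.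
rewrite mem_cat => /orP[/Hbs[b0 pb bq cb sb]|/Hcs[b0 pb bq cb sb]].
  by split=> // x /sb; rewrite def_m mem_cat => ->.
by split=> // x /sb; rewrite def_m mem_cat orbC => ->.
Qed.

(** Maximal runs of blocks with exact value [e] are iterated at cost [K + K]; a small block after
    such a run makes the whole piece small, with constant [K + K + K]. If no small block is met, the
    value is [sharp e], which is [e] or of smaller rank. *)
Lemma idempotent_blocks r F K (bs : seq (seq (seq A * S))) e :
    (forall K (ws : seq (seq A)), ws != [::] ->
       {in ws, forall w, small r K w} -> small r (F K) (flatten ws)) ->
    e ** e = e -> rank e <= r -> bs != [::] ->
    (forall b, b \in bs -> exact_or_small r K (word b) e) ->
  exact_or_small r (F (K + K + K) + (K + K)) (word (flatten bs)) e.
Proof.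
move=> HF ee le_e bs0 Hbs.
pose G (L : seq (seq (seq A * S))) := forall b, b \in L -> P K (word b) e.
have G_sharp L : L != [::] -> G L -> P (K + K) (flatten (map word L)) (sharp e).
  move=> L0 GL; apply: P_sharp => //; first by case: (L) L0.
  by move=> _ /mapP[b /GL Pb ->].
have [L b bb GL||w [L [def_w GL sL Hw]]] :=
  @greedy_small r F _ word G (K + K + K) bs HF.
- have [Pb|sb] := Hbs b bb.
    by left=> c; rewrite mem_rcons inE => /predU1P[->|/GL].
  right; rewrite map_rcons flatten_rcons; have [->|L0] := eqVneq L [::].
    by apply: small_le sb; rewrite leq_addl.
  exact: small_catr (G_sharp L L0 GL) sb.
- by [].
have -> : word (flatten bs) = flatten (map word bs).
  by elim: (bs) => //= b bs' <-; rewrite word_cat.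
case: Hw => [[w0 eL]|sw].
  have Psh : P (K + K) (flatten (map word bs)) (sharp e).
    by apply: G_sharp; rewrite // eL.
  case: bs bs0 Hbs eL {sL def_w w0} Psh => // b bs _ _ eL Psh.
  have Pe : P K (word b) e by apply: GL; rewrite -eL mem_head.
  have [ef fe ff] := sharp_ax Pe ee.
  have [eq_e|lt_e] := idempotent_below ef fe ff.
    by left; rewrite -eq_e; apply: P_le Psh; rewrite leq_addl.
  right; exists (sharp e); last exact: leq_trans lt_e le_e.
  by apply: P_le Psh; rewrite leq_addl.
right; rewrite def_w; have [->|L0] := eqVneq L [::].
  by rewrite cats0; apply: small_le sw; rewrite leq_addr.
exact: small_catl sw (G_sharp L L0 GL).
Qed.

(** The rank condition says that the product never falls below rank [r]. The induction is on the
    number of colours of cuts; without colours there is no cut and [l] is a single item. *)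
Lemma smooth_bounded r c : smalls_bounded r ->
  exists H, forall K l p q (C : {set S * S}), #|C| <= c -> l != [::] ->
    items r K l -> r <= rank (p ** value l ** q) -> cuts_in p q l C ->
  exact_or_small r (H K) (word l) (value l).
Proof.
move=> [F HF]; elim: c => [|c [H IH]].
  exists id => K [//|x l] p q C; rewrite leqn0 cards_eq0 => /eqP-> _ il _ cC.
  case: l il cC => [il _|y l _ /(_ [:: x] (y :: l) isT isT erefl)]; last first.
    by rewrite inE.
  by left; rewrite word1 value1; have [] := il x (mem_head _ _).
(* [M] is the constant of [idempotent_blocks]. The total pays [K] for the first item, [M (H K)] for
   the part up to the last cut coloured like the first one, and [H K] for the rest, which lacks that
   colour. *)
pose M k := F (k + k + k) + (k + k).
exists (fun K => K + (M (H K) + H K)) => K l p q C leC l0 il le_r cC.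
case: l l0 il le_r cC => // x l _ il le_r cC.
have Px : P K (word [:: x]) (value [:: x]).
  by rewrite word1 value1; have [] := il x (mem_head _ _).
case: l il le_r cC => [|y l'] il le_r cC; first by left; apply: P_le Px; rewrite leq_addr.
move: {l'}(y :: l') (isT : y :: l' != [::]) il le_r cC => l l0 il le_r cC.
set a := p ** value [:: x]; set b := value l ** q.
have [m [v [def_l v0 [am vb] cv]]] :=
  @last_cut p q ([:: x] ++ l) C (a, b) [:: x] l cC isT l0 erefl erefl.
have {}def_l : l = m ++ v by case: def_l.
have {}am : a ** value m = a by rewrite {1}/a -mulA -value_cat.
have leC' : #|C :\ (a, b)| <= c.
  have Cab : (a, b) \in C by apply: cC.
  by move: leC; rewrite (cardsD1 (a, b)) Cab.
have ab : p ** value (x :: l) ** q = a ** b.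
  by rewrite -cat1s value_cat !mulA.
have le_a : r <= rank a by rewrite ab in le_r; apply: leq_trans le_r (rank_mulr _ _).
have le_b : r <= rank b by rewrite ab in le_r; apply: leq_trans le_r (rank_mull _ _).
have iv : items r K v.
  by move=> z zv; apply: il; rewrite inE def_l mem_cat zv !orbT.
have im : items r K m.
  by move=> z zm; apply: il; rewrite inE def_l mem_cat zm !orbT.
have Ev : exact_or_small r (H K) (word v) (value v).
  apply: IH leC' v0 iv _ cv.
  by rewrite value_cat mulA -/a am -mulA vb -ab.
rewrite -cat1s def_l !word_cat !value_cat.
apply: exact_or_small_cat; first by left.
have [->|m0] := eqVneq m [::].
  rewrite [value [::]]big_nil mul1.
  case: Ev => [Pv|sv]; [left; apply: P_le Pv|right; apply: small_le sv];
    exact: leq_addl.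
apply: exact_or_small_cat => //.
have mb : value m ** b = b by rewrite -{1}vb mulA -value_cat -def_l.
have cm : cuts_in a b m C.
  have := @cuts_in_infix p q [:: x] m v C.
  by rewrite vb; apply; rewrite -def_l.
have [bs [def_m Hbs]] := fixed_blocks m0 am mb cm.
have bs0 : bs != [::] by apply: contraNneq m0 => bs0; rewrite -def_m bs0.
have ib d : d \in bs -> items r K d.
  by case/Hbs=> _ _ _ _ sd z /sd /im.
have rb d : d \in bs -> rank (value d) <= r.
  by move=> db; apply: rank_value (ib d db) _; case: (Hbs d db).
(* All blocks fix both [a] and [b], whose ranks are at least [r], so they share one idempotent
   value. *)
have eq_val d d' : d \in bs -> d' \in bs ->
    value d ** value d' = value d /\ value d = value d'.
  move=> db d'b; have [_ pd qd _ _] := Hbs d db.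
  have [_ pd' qd' _ _] := Hbs d' d'b.
  by apply: fixed_pair_unique pd qd pd' qd' _ _;
    apply: leq_trans (rb _ _) _.
pose e := value (head [::] bs).
have hb : head [::] bs \in bs by case: (bs) bs0 => // ? ? _; apply: mem_head.
have ee : e ** e = e by have [] := eq_val _ _ hb hb.
have eb d : d \in bs -> value d = e by move=> db; have [] := eq_val _ _ db hb.
have val_m : value m = e.
  rewrite -def_m; elim: (bs) bs0 eb => // d [|d' bs'] IHbs _ Hd.
    by rewrite /= cats0; apply: Hd; apply: mem_head.
  rewrite [flatten _]/(d ++ flatten (d' :: bs')) value_cat IHbs //.
    by rewrite Hd ?mem_head.
  by move=> d'' d''b; apply: Hd; rewrite inE d''b orbT.
rewrite -{1}def_m val_m; apply: idempotent_blocks => //; first exact: rb.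
move=> d db; rewrite -(eb d db); have [d0 pd qd cd _] := Hbs d db.
apply: IH leC' d0 (ib d db) _ cd.
by rewrite pd -ab.
Qed.

(** Extend a block of items of rank at most [r] while its product keeps rank at least [r]; such a
    block is covered by [smooth_bounded] with all colours allowed. The item that makes the rank drop
    completes a small word, and small words are combined by the induction hypothesis. *)
Lemma smalls_bounded_all r : smalls_bounded r.
Proof.
elim: r => [|r IHr].
  exists id => K [//|w ws] _ Hws; have [s _] := Hws w (mem_head _ _).
  by rewrite ltn0.
have [H HH] := smooth_bounded #|{: S * S}| IHr; have [F HF] := IHr.
exists (fun K => F (H K + K) + H K) => K ws ws0 Hws.
have [l def_ws il]: exists2 l, ws = map fst l & items r K l.
  elim: ws Hws {ws0} => [|w ws IHws] Hws; first by exists [::].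
  have [|l -> il] := IHws.
    by move=> v vws; apply: Hws; rewrite inE vws orbT.
  have [s Ps lts] := Hws w (mem_head _ _).
  by exists ((w, s) :: l) => // x; rewrite inE => /predU1P[->|/il].
have l0 : l != [::] by apply: contraNneq ws0 => l0; rewrite def_ws l0.
pose G L := items r K L /\ (L != [::] -> r <= rank (value L)).
have EL L : L != [::] -> G L -> exact_or_small r (H K) (word L) (value L).
  move=> L0 [iL /(_ L0) leL].
  have leC : #|[set: S * S]| <= #|{: S * S}| by rewrite cardsT.
  apply: (HH K L one one setT) => //; first by rewrite mul1 mulr1.
  by move=> u v _ _ _; rewrite inE.
have [L x xl [iL GL]||w [L [def_w GL sL Hw]]] :=
  @greedy_small r F _ fst G (H K + K) l HF.
- have iLx : items r K (rcons L x).
    by move=> y; rewrite mem_rcons inE => /predU1P[->|/iL]; first exact: il.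
  have [Px _] := il x xl.
  have [leLx|ltLx] := leqP r (rank (value (rcons L x))); first by left; split.
  right; rewrite map_rcons flatten_rcons.
  have [L_nil|L0] := eqVneq L [::].
    rewrite L_nil /= value1 in ltLx *; exists x.2 => //.
    by apply: P_le Px; rewrite leq_addl.
  rewrite -cats1 value_cat value1 in ltLx.
  have [PL|sL] := EL L L0 (conj iL GL); last exact: small_catl sL Px.
  by exists (value L ** x.2) => //; apply: P_mul.
- by split.
rewrite def_ws def_w; case: Hw => [[-> eL]|sw].
  rewrite -eL in GL *; have [PL|sL'] := EL l l0 GL.
    exists (value l); first by apply: P_le PL; rewrite leq_addl.
    by rewrite ltnS; apply: rank_value il l0.
  by case: sL' => s Ps lts; exists s; [apply: P_le Ps; apply: leq_addl|exact: ltnW].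
have [->|L0] := eqVneq L [::].
  rewrite cats0; case: sw => s Ps lts; exists s; last exact: ltnW.
  by apply: P_le Ps; rewrite leq_addr.
suff [s Ps lts] : small r (F (H K + K) + H K) (w ++ word L).
  by exists s => //; apply: ltnW.
have [PL|[t Pt _]] := EL L L0 GL; first exact: small_catl sw PL.
exact: small_catl sw Pt.
Qed.

Theorem bounded_evaluation K0 :
    (forall a, exists s, P K0 [:: a] s) ->
  exists K, forall w, w != [::] -> exists s, P K w s.
Proof.
(* No rank exceeds [#|S|], so every evaluation counts as small at [#|S|.+1]. *)
move=> letters; have [F HF] := smalls_bounded_all #|S|.+1.
exists (F K0) => w w0.
have [||s Ps _] := HF K0 [seq [:: a] | a <- w].
- by case: (w) w0.
- move=> _ /mapP[a _ ->]; have [s Ps] := letters a; exists s => //.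
  by rewrite ltnS /rank max_card.
by exists s; rewrite -[w]flatten_seq1.
Qed.

End Evaluation.
End FiniteMonoid.

(** * Limitedness *)

Section Relations.

Variable Q : finType.
Implicit Types (X Y Z : {set Q * Q}).

Definition relcomp X Y : {set Q * Q} :=
  [set p | [exists k, ((p.1, k) \in X) && ((k, p.2) \in Y)]].
Definition reldiag : {set Q * Q} := [set p | p.1 == p.2].

Lemma relcompP X Y i j :
  reflect (exists k, (i, k) \in X /\ (k, j) \in Y) ((i, j) \in relcomp X Y).
Proof. by rewrite inE; apply: (iffP existsP) => -[k /andP]; exists k. Qed.

Lemma relcompA : associative relcomp.
Proof.
move=> X Y Z; apply/setP=> -[i j]; apply/relcompP/relcompP.
  case=> k [Xik /relcompP[l [Ykl Zlj]]]; exists l; split=> //.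
  by apply/relcompP; exists k.
case=> l [/relcompP[k [Xik Ykl]] Zlj]; exists k; split=> //.
by apply/relcompP; exists l.
Qed.

Lemma relcomp1l : left_id reldiag relcomp.
Proof.
move=> X; apply/setP=> -[i j]; apply/relcompP/idP=> [[k []]|Xij].
  by rewrite inE => /eqP /= ->.
by exists i; rewrite inE /=.
Qed.

Lemma relcomp1r : right_id reldiag relcomp.
Proof.
move=> X; apply/setP=> -[i j]; apply/relcompP/idP=> [[k []]|Xij].
  by rewrite [_ \in reldiag]inE => Xik /eqP /= <-.
by exists j; rewrite [_ \in reldiag]inE /=.
Qed.

Lemma relcompS X X' Y Y' :
  X \subset X' -> Y \subset Y' -> relcomp X Y \subset relcomp X' Y'.
Proof.
move=> /subsetP sX /subsetP sY; apply/subsetP=> -[i j] /relcompP[k [Xik Ykj]].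
by apply/relcompP; exists k; split; [apply: sX|apply: sY].
Qed.

(** An idempotent relation is transitive and dense. Density gives [k] between [i] and [j]; if [k]
    has no loop, continue from [k], where fewer intermediate points remain because [k] itself is
    lost. *)
Lemma idempotent_rel_loop Z i j : relcomp Z Z = Z -> (i, j) \in Z ->
  exists k, [/\ (i, k) \in Z, (k, k) \in Z & (k, j) \in Z].
Proof.
move=> ZZ; pose W i := [set k | ((i, k) \in Z) && ((k, j) \in Z)].
have Ztr a b c : (a, b) \in Z -> (b, c) \in Z -> (a, c) \in Z.
  by move=> ? ?; rewrite -ZZ; apply/relcompP; exists b.
have [n] := ubnP #|W i|; elim: n i => // n IHn i lt_n Zij.
have [k [Zik Zkj]] : exists k, (i, k) \in Z /\ (k, j) \in Z.
  by apply/relcompP; rewrite ZZ.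
have [Zkk|nZkk] := boolP ((k, k) \in Z); first by exists k.
have [|l [Zkl Zll Zlj]] := IHn k _ Zkj; last first.
  by exists l; split=> //; apply: Ztr Zkl.
rewrite ltnS in lt_n; apply: leq_trans lt_n; apply: proper_card.
apply/properP; split; last by exists k; rewrite !inE ?Zik ?(negPf nZkk).
apply/subsetP=> l; rewrite !inE => /andP[Zkl ->]; rewrite andbT.
exact: Ztr Zkl.
Qed.

Definition relloops Z : {set Q * Q} := Z :&: reldiag.

Lemma relloopsP Z i j : (i, j) \in relloops Z -> i = j /\ (i, i) \in Z.
Proof. by rewrite !inE /= => /andP[Zij /eqP e]; rewrite -e in Zij. Qed.

Definition relsharp Z X := relcomp (relcomp X (relloops Z)) X.

Lemma relsharpP Z X i j :
  reflect (exists k, [/\ (i, k) \in X, (k, k) \in Z & (k, j) \in X])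
          ((i, j) \in relsharp Z X).
Proof.
apply: (iffP (relcompP _ _ _ _)) => [[k [/relcompP[l [Xil /relloopsP[e Zll]]] Xkj]]|].
  by exists k; rewrite e in Xil Zll.
case=> k [Xik Zkk Xkj]; exists k; split=> //; apply/relcompP; exists k.
by rewrite !inE /= eqxx andbT.
Qed.

Definition triple : Type := ({set Q * Q} * {set Q * Q} * {set Q * Q})%type.

(* The components of a triple are the pairs of cost zero, of bounded cost and of
   finite cost. *)
Definition zeros (s : triple) := s.1.1.
Definition bounds (s : triple) := s.1.2.
Definition reach (s : triple) := s.2.

Definition tmul (s t : triple) : triple :=
  (relcomp (zeros s) (zeros t), relcomp (bounds s) (bounds t),
   relcomp (reach s) (reach t)).
Definition tone : triple := (reldiag, reldiag, reldiag).
Definition tsharp (s : triple) : triple :=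
  (zeros s, relsharp (zeros s) (bounds s), reach s).

Lemma tmulA : associative tmul.
Proof. by move=> s t u; rewrite /tmul /zeros /bounds /reach /= !relcompA. Qed.

Lemma tmul1l : left_id tone tmul.
Proof. by move=> [[z b] r]; rewrite /tmul /zeros /bounds /reach /= !relcomp1l. Qed.

Lemma tmul1r : right_id tone tmul.
Proof. by move=> [[z b] r]; rewrite /tmul /zeros /bounds /reach /= !relcomp1r. Qed.

HB.instance Definition _ := Monoid.isLaw.Build triple tone tmul tmulA tmul1l tmul1r.

Lemma tmul_idempotent e : tmul e e = e ->
  [/\ relcomp (zeros e) (zeros e) = zeros e,
      relcomp (bounds e) (bounds e) = bounds e &
      relcomp (reach e) (reach e) = reach e].
Proof. by case: e => -[z b] r [-> -> ->]. Qed.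

(** The point is that the middle component is idempotent: a path through a free loop at [k] splits
    at [k] into two such paths, the loop being also in [bounds e]. *)
Lemma tsharp_idempotent e : zeros e \subset bounds e -> tmul e e = e ->
  [/\ tmul e (tsharp e) = tsharp e, tmul (tsharp e) e = tsharp e
    & tmul (tsharp e) (tsharp e) = tsharp e].
Proof.
case: e => -[z b] r; rewrite /tmul /tsharp /zeros /bounds /reach /= => szb.
case=> zz bb rr.
have bl : relcomp b (relsharp z b) = relsharp z b by rewrite !relcompA bb.
have br : relcomp (relsharp z b) b = relsharp z b by rewrite -relcompA bb.
split; rewrite ?zz ?rr ?bl ?br //; congr (_, _, _); apply/eqP.
rewrite eqEsubset; apply/andP; split.
  rewrite -{3}br; apply: relcompS => //; apply/subsetP=> -[i j].
  case/relsharpP=> k [bik _ bkj]; rewrite -bb; apply/relcompP.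
  by exists k.
apply/subsetP=> -[i j] /relsharpP[k [bik zkk bkj]]; apply/relcompP; exists k.
have bkk : (k, k) \in b by apply: (subsetP szb).
by split; apply/relsharpP; exists k.
Qed.

End Relations.

Lemma uniform_bound (T : finType) (P : nat -> T -> Prop) :
    (forall K L t, K <= L -> P K t -> P L t) ->
  exists K, forall t, (exists k, P k t) -> P K t.
Proof.
move=> P_le.
have /choice[f Hf] t : exists k', (exists k, P k t) -> P k' t.
  by have [[k Pk]|nP] := EM (exists k, P k t); [exists k | exists 0].
exists (\max_t f t) => t /Hf; apply: P_le.
exact: leq_bigmax.
Qed.

(** * Stable sets of triples characterize limitedness *)

Section Limitedness.

Variables (Q A : finType) (cost_le : nat -> seq A -> Q -> Q -> Prop).
Variables (I F : Q -> Prop).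
Hypothesis cost_mono : forall K L w i j,
  K <= L -> cost_le K w i j -> cost_le L w i j.
Hypothesis cost_nil : forall i, cost_le 0 [::] i i.
Hypothesis cost_cat : forall K L u v i k j,
  cost_le K u i k -> cost_le L v k j -> cost_le (K + L) (u ++ v) i j.
Hypothesis cost_split : forall K u v i j, cost_le K (u ++ v) i j ->
  exists K1 K2 k, [/\ K1 + K2 = K, cost_le K1 u i k & cost_le K2 v k j].

Definition limited := exists K, forall w,
  (exists k i f, [/\ I i, F f & cost_le k w i f]) ->
  exists i f, [/\ I i, F f & cost_le K w i f].

Definition zero_rel w : {set Q * Q} := [set p | `[< cost_le 0 w p.1 p.2 >]].
Definition reach_rel w : {set Q * Q} :=
  [set p | `[< exists k, cost_le k w p.1 p.2 >]].

Lemma zero_relP w i j : reflect (cost_le 0 w i j) ((i, j) \in zero_rel w).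
Proof. by rewrite inE; apply: asboolP. Qed.

Lemma reach_relP w i j :
  reflect (exists k, cost_le k w i j) ((i, j) \in reach_rel w).
Proof. by rewrite inE; apply: asboolP. Qed.

Lemma zero_rel_cat u v : zero_rel (u ++ v) = relcomp (zero_rel u) (zero_rel v).
Proof.
apply/setP=> -[i j]; apply/zero_relP/relcompP.
  case/cost_split=> K1 [K2 [k [/eqP]]]; rewrite addn_eq0.
  by case/andP=> /eqP-> /eqP-> c1 c2; exists k; split; apply/zero_relP.
by case=> k [/zero_relP c1 /zero_relP c2]; apply: cost_cat c1 c2.
Qed.

Lemma reach_rel_cat u v : reach_rel (u ++ v) = relcomp (reach_rel u) (reach_rel v).
Proof.
apply/setP=> -[i j]; apply/reach_relP/relcompP.
  case=> K /cost_split[K1 [K2 [k [_ c1 c2]]]]; exists k.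
  by split; apply/reach_relP; [exists K1|exists K2].
case=> k [/reach_relP[K1 c1] /reach_relP[K2 c2]]; exists (K1 + K2).
exact: cost_cat c1 c2.
Qed.

(** On a single letter only finitely many costs occur, so finite cost and bounded cost agree. *)
Definition letter_triple a : triple Q :=
  (zero_rel [:: a], reach_rel [:: a], reach_rel [:: a]).

Definition stable_set (C : triple Q -> Prop) :=
  [/\ forall a, C (letter_triple a),
      forall s t, C s -> C t -> C (tmul s t) &
      forall e, C e -> tmul e e = e -> C (tsharp e)].

Definition no_gap (C : triple Q -> Prop) := forall s, C s ->
  (exists i f, [/\ I i, F f & (i, f) \in reach s]) ->
  exists i f, [/\ I i, F f & (i, f) \in bounds s].

(* [power w m] is [w] to the power [m + 1]. *)
Definition power (w : seq A) m := iter m (cat w) w.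

(* In a run of cost at most [m] on [w^(m+1)], some factor [w] costs nothing;
   idempotency yields a state with a free loop on it. *)
Lemma power_sharp n w e : tmul e e = e -> zero_rel w = zeros e ->
    (forall i j, cost_le n w i j -> (i, j) \in bounds e) ->
  forall i j, cost_le n (power w n) i j -> (i, j) \in relsharp (zeros e) (bounds e).
Proof.
move=> /tmul_idempotent[zz bb rr] zw bw.
have zb i j : (i, j) \in zeros e -> (i, j) \in bounds e.
  by rewrite -zw => /zero_relP c; apply: bw; apply: cost_mono c.
have btr i k j : (i, k) \in bounds e -> (k, j) \in bounds e -> (i, j) \in bounds e.
  by move=> ? ?; rewrite -[bounds e]bb; apply/relcompP; exists k.
have bpow m i j : cost_le n (power w m) i j -> (i, j) \in bounds e.
  elim: m i => [|m IHm] i; first exact: bw.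
  case/cost_split=> K1 [K2 [k [eK c1 c2]]]; apply: (@btr _ k).
    by apply: bw; apply: cost_mono c1; rewrite -eK leq_addr.
  by apply: IHm; apply: cost_mono c2; rewrite -eK leq_addl.
(* With [k <= m], the [m + 1] factors outnumber the units of cost. If the first factor is not free,
   the remaining factors have strictly less cost to share. *)
suff Hm m k i j : k <= m -> k <= n -> cost_le k (power w m) i j ->
    (i, j) \in relsharp (zeros e) (bounds e).
  by move=> i j; apply: Hm.
elim: m k i => [|m IHm] k i.
  rewrite leqn0 => /eqP-> _ /zero_relP; rewrite zw.
  case/(idempotent_rel_loop zz) => l [zil zll zlj].
  by apply/relsharpP; exists l; split=> //; apply: zb.
move=> lekm lekn /cost_split[[|K1] [K2 [l [eK c1 c2]]]].
  have /(idempotent_rel_loop zz)[q [ziq zqq zql]]: (i, l) \in zeros e.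
    by rewrite -zw; apply/zero_relP.
  apply/relsharpP; exists q; split=> //; first exact: zb.
  apply: btr (zb _ _ zql) _; apply: (bpow m); apply: cost_mono c2.
  by rewrite -[K2]add0n eK.
have /relsharpP[q [blq zqq bqj]] : (l, j) \in relsharp (zeros e) (bounds e).
  apply: IHm c2; last by apply: leq_trans lekn; rewrite -eK leq_addl.
  by rewrite -ltnS; apply: leq_trans lekm; rewrite -eK addSn ltnS leq_addl.
apply/relsharpP; exists q; split=> //; apply: btr blq; apply: bw.
by apply: cost_mono c1; apply: leq_trans lekn; rewrite -eK leq_addr.
Qed.

Definition witnessed (s : triple Q) := forall n, exists w,
  [/\ w != [::], zero_rel w = zeros s, reach_rel w = reach s &
      forall i j, cost_le n w i j -> (i, j) \in bounds s].

Lemma stable_witnessed : stable_set witnessed.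
Proof.
split=> [a n|s t ws wt n|e we ee n].
- exists [:: a]; split=> // i j c; apply/reach_relP.
  by exists n.
- have [u [u0 zu ru bu]] := ws n; have [v [v0 zv rv bv]] := wt n.
  exists (u ++ v); split; first by case: (u) u0.
  - by rewrite zero_rel_cat zu zv.
  - by rewrite reach_rel_cat ru rv.
  move=> i j /cost_split[K1 [K2 [k [eK c1 c2]]]]; apply/relcompP; exists k.
  by split; [apply: bu; apply: cost_mono c1|apply: bv; apply: cost_mono c2];
    rewrite -eK ?leq_addr ?leq_addl.
(* For threshold [n], the witness of the iteration is [n + 1] copies of the witness of [e]. *)
have [w [w0 zw rw bw]] := we n; exists (power w n); split.
- by rewrite /power; case: n {bw} => //= m; case: (w) w0.
- have [zz _ _] := tmul_idempotent ee; elim: (n) => //= m IHm.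
  by rewrite zero_rel_cat IHm zw.
- have [_ _ rr] := tmul_idempotent ee; elim: (n) => //= m IHm.
  by rewrite reach_rel_cat IHm rw.
exact: power_sharp.
Qed.

(** The inclusions point so that every finite cost of [w] is seen in [reach s], while [zeros s] and
    [bounds s] only promise runs that exist on [w]. *)
Definition dominated (C : triple Q -> Prop) K w s :=
  [/\ C s, zeros s \subset bounds s, reach_rel w \subset reach s,
      zeros s \subset zero_rel w &
      forall i j, (i, j) \in bounds s -> cost_le K w i j].

Lemma dominated_bounded C : stable_set C ->
  exists K, forall w, w != [::] -> exists s, dominated C K w s.
Proof.
case=> Ca Cm Cs.
have [K0 HK0] : exists K0, forall t : A * (Q * Q),
    (exists k, cost_le k [:: t.1] t.2.1 t.2.2) ->
    cost_le K0 [:: t.1] t.2.1 t.2.2.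
  by apply: uniform_bound => K L t; apply: cost_mono.
apply: (@bounded_evaluation _ _ (@tmul Q) A (dominated C) (@tsharp Q) _ _ _ _ K0).
- move=> K L w s leKL [? ? ? ? bs]; split=> // i j /bs.
  exact: cost_mono.
- move=> K L w v s t [Cs' zbs rs zs bs] [Ct zbt rt zt bt]; split.
  + exact: Cm.
  + exact: relcompS.
  + by rewrite reach_rel_cat; apply: relcompS.
  + by rewrite zero_rel_cat; apply: relcompS.
  move=> i j /relcompP[k [/bs c1 /bt c2]]; exact: cost_cat c1 c2.
- move=> K ws e ee ws0 Hws; have [zz bb rr] := tmul_idempotent ee.
  have [Ce zbe]: C e /\ zeros e \subset bounds e.
    case: (ws) ws0 Hws => // w ws' _ /(_ w (mem_head _ _)) [] //.
  have bsh : relsharp (zeros e) (bounds e) \subset bounds e.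
    apply/subsetP=> -[i j] /relsharpP[k [bik _ bkj]].
    by rewrite -[bounds e]bb; apply/relcompP; exists k.
  have Hzr : reach_rel (flatten ws) \subset reach e /\
             zeros e \subset zero_rel (flatten ws).
    elim: ws ws0 Hws => // w [|w' ws] IH _ Hws.
      by have [_ _ ? ? _] := Hws w (mem_head _ _); rewrite /= cats0.
    have [_ _ rw zw _] := Hws w (mem_head _ _).
    have [||rws zws] := IH; first by [].
      by move=> v vws; apply: Hws; rewrite inE vws orbT.
    rewrite [flatten _]/(w ++ flatten (w' :: ws)) reach_rel_cat zero_rel_cat.
    by rewrite -[reach e]rr -[zeros e]zz; split; apply: relcompS.
  have [rws zws] := Hzr; split=> //=.
  + exact: Cs.
  (* A free pair of an idempotent passes through a free loop, so it survives the iteration. *)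
  + apply/subsetP=> -[i j] /(idempotent_rel_loop zz)[k [zik zkk zkj]].
    by apply/relsharpP; exists k; split=> //; apply: (subsetP zbe).
  move=> i j; case/lastP: ws ws0 Hws {Hzr rws zws} => // ws w _ Hws.
  have Hw : dominated C K w e by apply: Hws; rewrite mem_rcons mem_head.
  have [_ _ _ _ bw] := Hw.
  rewrite flatten_rcons; case: ws Hws => [|w' ws] Hws.
    move=> bij; rewrite cat0s; apply: cost_mono (bw _ _ _) => //; first exact: leq_addr.
    exact: (subsetP bsh).
  (* The first and the last word cost at most [K] each; the words between them loop on [k] for
     free. *)
  case/relsharpP=> k [bik zkk bkj]; apply: cost_cat (bw _ _ bkj).
  have [_ _ _ _ bw'] : dominated C K w' e by apply: Hws; rewrite mem_head.
  rewrite -[K]addn0; apply: cost_cat (bw' _ _ bik) _.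
  have {}Hws v : v \in ws -> dominated C K v e.
    by move=> vws; apply: Hws; rewrite mem_rcons !inE vws !orbT.
  elim: ws Hws => [_|v ws IH Hws]; last first.
    have [_ _ _ /subsetP/(_ (k, k) zkk)/zero_relP cv _] := Hws v (mem_head _ _).
    apply: (cost_cat cv); apply: IH => u uws.
    by apply: Hws; rewrite inE uws orbT.
  exact: cost_nil.
- by move=> K w e [_ zbe _ _ _] ee; apply: tsharp_idempotent.
move=> a; exists (letter_triple a); split=> //.
- by apply/subsetP=> -[i j] /zero_relP c; apply/reach_relP; exists 0.
by move=> i j /reach_relP; apply: HK0 (a, (i, j)).
Qed.

Theorem limitedP : limited <-> exists C, stable_set C /\ no_gap C.
Proof.
split=> [[K HK]|[C [stC ngC]]].
  exists witnessed; split=> [|s ws [i [f [Ii Ff]]]]; first exact: stable_witnessed.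
  have [w [_ _ rw bw]] := ws K; rewrite -rw => /reach_relP[k c].
  have [|i' [f' [Ii' Ff' c']]] := HK w; first by exists k, i, f.
  by exists i', f'; split=> //; apply: bw.
have [K HK] := dominated_bounded stC.
(* The empty word is not covered by the evaluation and gets its own bound. *)
have [K0 HK0] := @uniform_bound (Q * Q)%type (fun k p => cost_le k [::] p.1 p.2)
  (fun K L p => @cost_mono K L [::] p.1 p.2).
exists (K0 + K) => w [k [i [f [Ii Ff c]]]].
have [w0|w0] := eqVneq w [::].
  exists i, f; split=> //; rewrite w0 in c *.
  by apply: cost_mono (HK0 (i, f) _); [apply: leq_addr|exists k].
have [s [Cs _ rs _ bs]] := HK w w0.
have [|i' [f' [Ii' Ff' b]]] := ngC s Cs.
  by exists i, f; split=> //; apply: (subsetP rs); apply/reach_relP; exists k.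
by exists i', f'; split=> //; apply: cost_mono (bs _ _ b); apply: leq_addl.
Qed.

End Limitedness.

(** * Uniformization and limitedness *)

Fixpoint run {A : eqType} (N : nfa A) (q : nat) (w : seq A) (q' : nat) : Prop :=
  if w is a :: w' then exists k, (q, a, k) \in nfa_trans N /\ run N k w' q'
  else q = q'.

Lemma run_cat (A : eqType) (N : nfa A) q w1 w2 q' :
  run N q (w1 ++ w2) q' <-> exists k, run N q w1 k /\ run N k w2 q'.
Proof.
elim: w1 q => [|a w1 IH] q /=; first by split=> [|[k [->]]]; [exists q|].
split=> [[k [tr /IH[l [r1 r2]]]]|[l [[k [tr r1]] r2]]].
  by exists l; split=> //; exists k.
by exists k; split=> //; apply/IH; exists l.
Qed.

Lemma nfa_acceptsP (A : eqType) (N : nfa A) w : nfa_accepts N w <->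
  exists q q', [/\ q \in nfa_init N, q' \in nfa_final N & run N q w q'].
Proof.
suff H q q' : run N q w q' <-> exists qs, [/\ last q qs = q', size qs = size w
    & all (fun t => t \in nfa_trans N) (zip (zip (belast q qs) w) qs)].
  split=> [[q [qs [qi qf sz tr]]]|[q [q' [qi qf /H[qs [lst sz tr]]]]]].
    by exists q, (last q qs); split=> //; apply/H; exists qs.
  by exists q, qs; split=> //; rewrite lst.
elim: w q => [|a w IH] q /=.
  by split=> [->|[[|? ?] [//= ]]]; first by exists [::].
split=> [[k [tr /IH[qs [lst sz tr']]]]|[[|k qs] [lst //= [sz] /andP[tr tr']]]].
  by exists (k :: qs); split=> //=; rewrite ?sz ?tr.
by exists k; split=> //; apply/IH; exists qs.
Qed.

(* The languages saturated by a right congruence of finite index, given by its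
   quotient map. *)
Definition finite_index {A : eqType} (L : seq A -> Prop) : Prop :=
  exists (Q : finType) (h : seq A -> Q),
    (forall u v a, h u = h v -> h (rcons u a) = h (rcons v a)) /\
    (forall u v, h u = h v -> L u -> L v).

(** The classes are the states, numbered by [enum_rank]. Right congruence makes the transition from
    a realized class deterministic, so a run from the class of [[::]] computes the class of the word
    read. *)
Lemma finite_index_regular (A : finType) (L : seq A -> Prop) :
  finite_index L -> regular L.
Proof.
case=> Q [h [h_rcons h_sat]].
pose r u : nat := enum_rank (h u).
have r_inj u v : r u = r v -> h u = h v by move=> /val_inj/enum_rank_inj.
pose tr := [seq ((enum_rank t.1.1 : nat), t.1.2, (enum_rank t.2 : nat))
  | t <- enum {: Q * A * Q} &
    `[< exists u, h u = t.1.1 /\ h (rcons u t.1.2) = t.2 >]].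
pose fin := [seq (enum_rank q : nat) | q <- enum Q & `[< exists u, h u = q /\ L u >]].
pose N : nfa A := (tr, [:: r [::]], fin).
have trP u a k : (r u, a, k) \in tr <-> k = r (rcons u a).
  split=> [/mapP[[[q b] q'] /=]|->].
    rewrite mem_filter => /andP[/asboolP /= [v [hv hva]] _] [ruq -> ->].
    by rewrite -hva /r (h_rcons u v) // hv; apply/enum_rank_inj/val_inj.
  apply/mapP; exists (h u, a, h (rcons u a)) => //.
  by rewrite mem_filter mem_enum andbT; apply/asboolP; exists u.
have runP w u k : run N (r u) w k <-> k = r (u ++ w).
  elim: w u k => [|a w IH] u k /=; first by rewrite cats0; split.
  rewrite -cat_rcons; split=> [[l [/trP-> /IH]]|->] //.
  by exists (r (rcons u a)); split; [apply/trP|apply/IH].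
exists N => w; rewrite nfa_acceptsP; split=> [Lw|[q [q' []]]].
  exists (r [::]), (r w); split; [exact: mem_head| |exact/runP].
  apply/mapP; exists (h w) => //; rewrite mem_filter mem_enum andbT.
  by apply/asboolP; exists w.
rewrite inE => /eqP-> /mapP[p]; rewrite mem_filter => /andP[/asboolP[u [hu Lu]] _ ->].
move=> /runP rw; apply: h_sat Lu; rewrite hu.
exact/enum_rank_inj/val_inj.
Qed.

Lemma finite_index_not (A : eqType) (L : seq A -> Prop) :
  finite_index L -> finite_index (fun u => ~ L u).
Proof.
case=> Q [h [h_rcons h_sat]]; exists Q, h; split=> // u v huv nLu Lv.
by apply: nLu; apply: h_sat Lv.
Qed.

Lemma finite_index_and (A : eqType) (L1 L2 : seq A -> Prop) :
  finite_index L1 -> finite_index L2 -> finite_index (fun u => L1 u /\ L2 u).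
Proof.
case=> Q1 [h1 [h1_rcons h1_sat]] [Q2 [h2 [h2_rcons h2_sat]]].
exists (Q1 * Q2)%type, (fun u => (h1 u, h2 u)); split=> [u v a [e1 e2]|u v [e1 e2] [L1u L2u]].
  by congr (_, _); auto.
by split; [apply: h1_sat L1u|apply: h2_sat L2u].
Qed.

Lemma finite_index_forall (A : eqType) n (L : nat -> seq A -> Prop) :
  (forall j, j < n -> finite_index (L j)) ->
  finite_index (fun u => forall j, j < n -> L j u).
Proof.
elim: n => [|n IHn] fL; first by exists unit, (fun=> tt); split.
have [Q [h [h_rcons h_sat]]] :=
  finite_index_and (fL n (leqnn _)) (IHn (fun j lt => fL j (ltnW lt))).
exists Q, h; split=> // u v huv Lu j.
have [Lnv Lv] : L n v /\ (forall j, j < n -> L j v).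
  apply: h_sat huv _; split=> [|i lti]; first exact: Lu.
  exact/Lu/ltnW.
by rewrite ltnS leq_eqVlt => /predU1P[->|/Lv].
Qed.

Lemma cat_eq_take (T : eqType) (u v c : seq T) k : u ++ v = take k c ->
  u = take (size u) c /\ size u <= size c.
Proof.
move=> e; have pu : prefix u c.
  by apply: (@catl_prefix _ _ _ v); rewrite e prefix_take.
by split; [apply/esym/eqP; rewrite -prefixE | apply: size_prefix].
Qed.

(** The class of [v] records which prefix of [c] it is, if any. *)
Lemma finite_index_singleton (A : eqType) (c : seq A) :
  finite_index (fun v => v = c).
Proof.
pose h v := [set k : 'I_(size c).+1 | v == take k c].
exists {set 'I_(size c).+1}, h; split=> [u v a huv|u v].
  suff H u1 u2 : h u1 = h u2 -> h (rcons u1 a) \subset h (rcons u2 a).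
    by apply/eqP; rewrite eqEsubset !H.
  move=> h12; apply/subsetP=> k; rewrite !inE => /eqP ek.
  have [eu1 le_u] : u1 = take (size u1) c /\ size u1 <= size c.
    by apply: (@cat_eq_take _ _ [:: a] _ k); rewrite cats1.
  have : inord (size u1) \in h u1 by rewrite inE inordK ?ltnS // -eu1.
  by rewrite h12 inE inordK ?ltnS // -eu1 => /eqP->; rewrite -ek.
move=> huv eu; have : ord_max \in h u by rewrite inE eu take_size.
by rewrite huv inE take_size => /eqP.
Qed.

Lemma proj_i_cat (S G : Type) (w1 w2 : seq (S + G)) :
  proj_i (w1 ++ w2) = proj_i w1 ++ proj_i w2.
Proof. exact: pmap_cat. Qed.

Lemma proj_o_cat (S G : Type) (w1 w2 : seq (S + G)) :
  proj_o (w1 ++ w2) = proj_o w1 ++ proj_o w2.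
Proof. exact: pmap_cat. Qed.

Lemma proj_i_split (S G : Type) (w : seq (S + G)) u v : proj_i w = u ++ v ->
  exists w1 w2, [/\ w = w1 ++ w2, proj_i w1 = u & proj_i w2 = v].
Proof.
elim: w u => [|[a|b] w IH] u /=.
- by case: u v => [|//] [|//] _; exists [::], [::].
- case: u => [|c u] /= e; first by exists [::], (inl a :: w).
  case: e => <- /IH[w1 [w2 [-> <- <-]]].
  by exists (inl a :: w1), w2.
by move=> /IH[w1 [w2 [-> <- <-]]]; exists (inr b :: w1), w2.
Qed.

Definition states_below {A : eqType} (N : nfa A) m : Prop :=
  [/\ {in nfa_init N, forall q, q < m}, {in nfa_final N, forall q, q < m} &
      {in nfa_trans N, forall t, t.2 < m}].

Lemma run_below (A : eqType) (N : nfa A) m q w q' :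
  states_below N m -> q < m -> run N q w q' -> q' < m.
Proof.
case=> _ _ tr_m; elim: w q => [|a w IH] q lt_q /=; first by move=> <-.
by case=> k [/tr_m lt_k r]; apply: IH r.
Qed.

Section Uniformization.

Variables (Sigma Gamma : finType) (N : nfa (Sigma + Gamma)) (m : nat).
Hypothesis N_m : states_below N m.

Definition cost_le K u (i j : 'I_m) : Prop :=
  exists w, [/\ run N i w j, proj_i w = u & size (proj_o w) <= K].

Lemma cost_le_mono K L u i j : K <= L -> cost_le K u i j -> cost_le L u i j.
Proof. by move=> leKL [w [r pw sz]]; exists w; split=> //; apply: leq_trans leKL. Qed.

Lemma cost_le_nil i : cost_le 0 [::] i i.
Proof. by exists [::]. Qed.

Lemma cost_le_cat K L u v i k j :
  cost_le K u i k -> cost_le L v k j -> cost_le (K + L) (u ++ v) i j.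
Proof.
move=> [w1 [r1 <- s1]] [w2 [r2 <- s2]]; exists (w1 ++ w2); split.
- by apply/run_cat; exists k.
- exact: proj_i_cat.
by rewrite proj_o_cat size_cat leq_add.
Qed.

Lemma cost_le_split K u v i j : cost_le K (u ++ v) i j ->
  exists K1 K2 k, [/\ K1 + K2 = K, cost_le K1 u i k & cost_le K2 v k j].
Proof.
case=> w [r /proj_i_split[w1 [w2 [ew <- <-]]] sz]; subst w.
have /run_cat[k [r1 r2]] := r.
have lt_k : k < m by apply: run_below r1.
rewrite proj_o_cat size_cat in sz.
exists (size (proj_o w1)), (K - size (proj_o w1)), (Ordinal lt_k); split.
- by rewrite subnKC //; apply: leq_trans sz; apply: leq_addr.
- by exists w1.
by exists w2; split=> //; rewrite leq_subRL // (leq_trans (leq_addr _ _) sz).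
Qed.

Definition init_state (i : 'I_m) : Prop := (i : nat) \in nfa_init N.
Definition final_state (i : 'I_m) : Prop := (i : nat) \in nfa_final N.

Lemma rat_relP u v : rat_rel N u v <-> exists w (i f : 'I_m),
  [/\ init_state i, final_state f, run N i w f, proj_i w = u & proj_o w = v].
Proof.
split=> [[w [/nfa_acceptsP[q [q' [qi qf r]]] pi po]]|[w [i [f [Ii Ff r pi po]]]]].
  have [iN fN _] := N_m.
  by exists w, (Ordinal (iN q qi)), (Ordinal (fN q' qf)).
by exists w; split=> //; apply/nfa_acceptsP; exists (i : nat), (f : nat).
Qed.

(** The class of [u] records the states reachable while reading [u] and writing a prefix of [v],
    together with the length of that prefix. *)
Lemma rat_rel_finite_index v : finite_index (fun u => rat_rel N u v).
Proof.
pose h u := [set p : 'I_m * 'I_(size v).+1 | `[< exists w (i : 'I_m),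
  [/\ init_state i, run N i w p.1, proj_i w = u & proj_o w = take p.2 v] >]].
exists {set 'I_m * 'I_(size v).+1}, h; split=> [u1 u2 a h12|u1 u2 h12].
  suff H u u' : h u = h u' -> h (rcons u a) \subset h (rcons u' a).
    by apply/eqP; rewrite eqEsubset !H.
  move=> huu'; apply/subsetP=> -[q k]; rewrite !inE /=.
  case/asboolP=> w [i [Ii r]]; rewrite -cats1.
  move=> /proj_i_split[w1 [w2 [ew pw1 pw2]]] po; subst w.
  have /run_cat[l [r1 r2]] := r; have lt_l : l < m by apply: run_below r1.
  rewrite proj_o_cat in po.
  have [po1 le_v] := cat_eq_take po.
  have : (Ordinal lt_l, inord (size (proj_o w1))) \in h u.
    rewrite inE; apply/asboolP; exists w1, i; split=> //=.
    by rewrite inordK ?ltnS.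
  rewrite huu' inE => /asboolP[w1' [i' [Ii' r1' pw1']]] /=.
  rewrite inordK ?ltnS // -po1 => po1'.
  apply/asboolP; exists (w1' ++ w2), i'; split=> //.
  - by apply/run_cat; exists l.
  - by rewrite proj_i_cat pw1' pw2 cats1.
  by rewrite proj_o_cat po1'.
move=> /rat_relP[w [i [f [Ii Ff r pi po]]]]; apply/rat_relP.
have : (f, ord_max) \in h u1.
  by rewrite inE; apply/asboolP; exists w, i; rewrite /= take_size.
rewrite h12 inE => /asboolP[w' [i' [Ii' r' pi' po']]].
by exists w', i', f; rewrite /= take_size in po'; split.
Qed.

Lemma short_words K : exists vs : seq (seq Gamma), forall v, size v <= K -> v \in vs.
Proof.
elim: K => [|K [vs IH]].
  by exists [:: [::]] => -[].
exists ([::] :: [seq a :: v | a <- enum Gamma, v <- vs]) => -[//|a v] /= szv.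
by rewrite inE /=; apply/allpairsP; exists (a, v); rewrite mem_enum IH.
Qed.

(** List the finitely many words of length at most [K] and let [g u] be the first one related to
    [u]. Its graph is the union over [i] of the inputs whose first hit is [i], times a singleton. *)
Lemma uniformization_of_bound K :
    (forall u, dom (rat_rel N) u -> exists v, rat_rel N u v /\ size v <= K) ->
  has_rec_uniformization (rat_rel N).
Proof.
move=> bK; have [vs Hvs] := short_words K.
pose R u v := `[< rat_rel N u v >].
have domR u : dom (rat_rel N) u -> has (R u) vs.
  move=> /bK[v [Ruv szv]]; apply/hasP; exists v; first exact: Hvs.
  exact/asboolP.
exists (fun u => nth [::] vs (find (R u) vs)); split.
  by move=> u /domR hasR; apply/asboolP/(nth_find [::] hasR).
exists (size vs), (fun i u => rat_rel N u (nth [::] vs i) /\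
  forall j, j < i -> ~ rat_rel N u (nth [::] vs j)), (fun i v => v = nth [::] vs i).
split=> [i lti|u v].
  split; apply: finite_index_regular; last exact: finite_index_singleton.
  apply: finite_index_and; first exact: rat_rel_finite_index.
  apply: finite_index_forall => j _; apply: finite_index_not.
  exact: rat_rel_finite_index.
split=> [[/domR hasR ->]|[i lti [[Ri nR] ->]]].
  exists (find (R u) vs); first by rewrite -has_find.
  split=> //; split=> [|j ltj]; first exact/asboolP/(nth_find [::] hasR).
  by move/negbT: (before_find [::] ltj) => /asboolP.
split; first by exists (nth [::] vs i).
congr nth; apply/eqP; rewrite eqn_leq; apply/andP; split.
  rewrite leqNgt; apply/negP=> /nR; apply.
  have hasR : has (R u) vs by apply/(has_nthP [::]); exists i => //; apply/asboolP.
  exact/asboolP/(nth_find [::] hasR).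
rewrite leqNgt; apply/negP=> lti'.
by move/negbT: (before_find [::] lti') => /asboolP; apply.
Qed.

Lemma uniformization_iff_limited :
  has_rec_uniformization (rat_rel N) <-> limited cost_le init_state final_state.
Proof.
split=> [[g [Rg [n [U [V [_ HUV]]]]]]|[K HK]].
  have [K HK] := @uniform_bound 'I_n
    (fun K i => forall u v, U i u -> V i v -> size v <= K)
    (fun K L i leKL HK u v Uu Vv => leq_trans (HK u v Uu Vv) leKL).
  exists K => u [k [i [f [Ii Ff [w [r pi _]]]]]].
  have Du : dom (rat_rel N) u.
    by exists (proj_o w); apply/rat_relP; exists w, i, f.
  have [l ltl [Uu Vg]] := (HUV u (g u)).1 (conj Du erefl).
  (* Every element of [V l] is paired with [u] in the graph, so it equals [g u]; hence the index [l]
     admits some bound and [K] applies to it. *)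
  have szg : size (g u) <= K.
    apply: (HK (Ordinal ltl) _ u (g u) Uu Vg); exists (size (g u)) => u' v Uu' Vv.
    have [_ ->] : dom (rat_rel N) u /\ v = g u; last by [].
    by apply/HUV; exists l.
  have /rat_relP[w' [i' [f' [Ii' Ff' r' pi' po']]]] := Rg u Du.
  by exists i', f'; split=> //; exists w'; rewrite po'.
apply: (@uniformization_of_bound K) => u [v /rat_relP[w [i [f [Ii Ff r pi po]]]]].
have [|i' [f' [Ii' Ff' [w' [r' pi' sz']]]]] := HK u.
  by exists (size v), i, f; split=> //; exists w; rewrite po.
exists (proj_o w'); split=> //; apply/rat_relP.
by exists w', i', f'.
Qed.

End Uniformization.

(** * The limitedness criterion as a bounded formula *)

(** Division by a power of two, with a bounded quantifier over the remainder. *)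
Definition quotient_pow2 c p q := bexists (2 ^ p) (fun r => c = q * 2 ^ p + r).
Definition bit c i := bexists c.+1 (fun q => quotient_pow2 c i (q + q).+1).
(** This is the value of [pickle] on a pair whose components have codes [a] and [b]. *)
Definition code2 a b := 2 ^ a * (2 ^ b + 2 ^ b).+1.

(* The suffixes [d] of the list coded by [c] are read off the binary expansion:
   each is preceded by a digit 1. *)
Definition code_mem n c := bexists c.+1 (fun d =>
  (d = c \/ bexists c.+1 (fun p => quotient_pow2 c p (d + d).+1)) /\
  bexists c.+1 (fun e => d = 2 ^ n * (e + e).+1)).

(** A relation on [n] states is a number below [2 ^ (n * n)], whose bits form its matrix row by
    row. *)
Definition rel_bit n z i j := bit z (i * n + j).
Definition rel_eq n z (P : nat -> nat -> Prop) :=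
  bforall n (fun i => bforall n (fun j => rel_bit n z i j <-> P i j)).
Definition rel_comp n z x y :=
  rel_eq n z (fun i j => bexists n (fun k => rel_bit n x i k /\ rel_bit n y k j)).
Definition rel_sharp n b' z b :=
  rel_eq n b' (fun i j => bexists n (fun k =>
    rel_bit n b i k /\ rel_bit n z k k /\ rel_bit n b k j)).

Section Formula.

Variables Sigma Gamma : finType.

Definition input_step t (a : Sigma) i j :=
  code_mem (code2 (code2 i (pickle (inl a : Sigma + Gamma))) j) t.
Definition output_step t i j :=
  fexists (fun b : Gamma =>
    code_mem (code2 (code2 i (pickle (inr b : Sigma + Gamma))) j) t).

(** Reachability without coding paths: [j] lies in every set of states, given as a bit mask [s],
    that contains [i] and is closed under output steps. *)
Definition output_path n t i j := bforall (2 ^ n) (fun s =>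
  bit s i ->
  bforall n (fun k => bforall n (fun l => bit s k -> output_step t k l -> bit s l)) ->
  bit s j).

Definition letter_path n t a i j := bexists n (fun k => bexists n (fun l =>
  output_path n t i k /\ input_step t a k l /\ output_path n t l j)).

(** A set of triples is a bit mask [c]; the position of a triple has [z], [b], [r] as digits in base
    [2 ^ (n * n)]. *)
Definition code_in n c z b r := bit c ((z * 2 ^ (n * n) + b) * 2 ^ (n * n) + r).

Definition letters_formula n t c := fforall (fun a : Sigma =>
  bforall (2 ^ (n * n)) (fun z => bforall (2 ^ (n * n)) (fun r =>
  rel_eq n z (input_step t a) -> rel_eq n r (letter_path n t a) ->
  code_in n c z r r))).

Definition product_formula n c :=
  bforall (2 ^ (n * n)) (fun z1 => bforall (2 ^ (n * n)) (fun b1 =>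
  bforall (2 ^ (n * n)) (fun r1 => bforall (2 ^ (n * n)) (fun z2 =>
  bforall (2 ^ (n * n)) (fun b2 => bforall (2 ^ (n * n)) (fun r2 =>
  bforall (2 ^ (n * n)) (fun z => bforall (2 ^ (n * n)) (fun b =>
  bforall (2 ^ (n * n)) (fun r =>
  code_in n c z1 b1 r1 -> code_in n c z2 b2 r2 ->
  rel_comp n z z1 z2 -> rel_comp n b b1 b2 -> rel_comp n r r1 r2 ->
  code_in n c z b r))))))))).

Definition sharp_formula n c :=
  bforall (2 ^ (n * n)) (fun z => bforall (2 ^ (n * n)) (fun b =>
  bforall (2 ^ (n * n)) (fun r => bforall (2 ^ (n * n)) (fun b' =>
  code_in n c z b r ->
  rel_comp n z z z -> rel_comp n b b b -> rel_comp n r r r ->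
  rel_sharp n b' z b -> code_in n c z b' r)))).

Definition accepting n i f r := bexists n (fun p => bexists n (fun q =>
  code_mem p i /\ code_mem q f /\ rel_bit n r p q)).

Definition gap_formula n i f c :=
  bforall (2 ^ (n * n)) (fun z => bforall (2 ^ (n * n)) (fun b =>
  bforall (2 ^ (n * n)) (fun r =>
  code_in n c z b r -> accepting n i f r -> accepting n i f b))).

(** The code [n] of the automaton also serves as the number of states, since it exceeds every state
    occurring in a run; the components [t], [i], [f] are below it as well. *)
Definition limited_formula n :=
  bexists n.+1 (fun t => bexists n.+1 (fun i => bexists n.+1 (fun f =>
  n = code2 (code2 t i) f /\
  bexists (2 ^ (2 ^ (n * n) * 2 ^ (n * n) * 2 ^ (n * n))) (fun c =>
  letters_formula n t c /\ product_formula n c /\ sharp_formula n c /\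
  gap_formula n i f c)))).

End Formula.

Ltac computable_step := cbv beta; lazymatch goal with
  | |- computable _ (fun xs => @?F xs + @?G xs) => apply: (@computable_add _ F G)
  | |- computable _ (fun xs => @?F xs * @?G xs) => apply: (@computable_mul _ F G)
  | |- computable _ (fun xs => 2 ^ @?F xs) => apply: (@computable_exp2 _ F)
  | |- computable _ (fun xs => (@?F xs).+1) => apply: (@computable_succ _ F)
  | |- computable _ _ => first [exact: computable_const |
      eapply computable_var; intro; rewrite ?nth_behead; reflexivity]
  | |- computable_pred _ (fun xs => @?F xs = @?G xs) =>
      apply: (@computable_pred_eq _ F G)
  | |- computable_pred _ (fun xs => @?P xs /\ @?Q xs) =>
      apply: (@computable_pred_and _ P Q)
  | |- computable_pred _ (fun xs => @?P xs \/ @?Q xs) =>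
      apply: (@computable_pred_or _ P Q)
  | |- computable_pred _ (fun xs => @?P xs <-> @?Q xs) =>
      apply: (@computable_pred_iff _ P Q)
  | |- computable_pred _ (fun xs => bforall (@?B xs) (@?P xs)) =>
      apply: (@computable_pred_bforall _ B P)
  | |- computable_pred _ (fun xs => bexists (@?B xs) (@?P xs)) =>
      apply: (@computable_pred_bexists _ B P)
  | |- computable_pred _ (fun xs => @fforall ?T (@?P xs)) =>
      apply: (@computable_pred_fforall _ T P) => ?
  | |- computable_pred _ (fun xs => @fexists ?T (@?P xs)) =>
      apply: (@computable_pred_fexists _ T P) => ?
  | |- computable_pred _ (fun xs => @?P xs -> @?Q xs) =>
      apply: (@computable_pred_imp _ P Q)
  end.

Lemma computable_limited_formula Sigma Gamma :
  computable_pred 1 (fun xs => limited_formula Sigma Gamma (nth 0 xs 0)).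
Proof.
rewrite /limited_formula /gap_formula /accepting /sharp_formula /product_formula.
rewrite /letters_formula /code_in /letter_path /output_path /output_step.
rewrite /input_step /rel_sharp /rel_comp /rel_eq /rel_bit /code_mem /code2.
rewrite /bit /quotient_pow2.
by repeat computable_step.
Qed.

(** * Correctness of the formula *)

Lemma quotient_pow2P c p q : quotient_pow2 c p q <-> q = c %/ 2 ^ p.
Proof.
split=> [[r [ltr ->]]|->].
  by rewrite divnMDl ?expn_gt0 // divn_small // addn0.
exists (c %% 2 ^ p); rewrite ltn_mod expn_gt0; split=> //; exact: divn_eq.
Qed.

Lemma bitP c i : bit c i <-> odd (c %/ 2 ^ i).
Proof.
split=> [[q [_ /quotient_pow2P <-]]|oc]; first by rewrite addnn /= odd_double.
exists (c %/ 2 ^ i)./2; split; last first.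
  by apply/quotient_pow2P; rewrite addnn -add1n -[in RHS](odd_double_half (_ %/ _)) oc.
by rewrite ltnS -divn2 (leq_trans (leq_div _ _)) ?leq_div.
Qed.

Lemma bits_exist n (P : nat -> Prop) :
  exists2 c, c < 2 ^ n & forall i, i < n -> (bit c i <-> P i).
Proof.
elim: n P => [|n IHn] P; first by exists 0.
have [c ltc Hc] := IHn (fun i => P i.+1).
exists (`[< P 0 >] + c.*2); first by rewrite expnS; case: asbool; lia.
case=> [_|i lti]; rewrite bitP.
  by rewrite expn0 divn1 oddD odd_double addbF oddb; split=> /asboolP.
have -> : (`[< P 0 >] + c.*2) %/ 2 ^ i.+1 = c %/ 2 ^ i.
  have b2 : `[< P 0 >] %/ 2 = 0 by case: asbool.
  by rewrite expnS divnMA addnC -muln2 divnMDl // b2 addn0.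
by rewrite -bitP; apply: Hc.
Qed.

(** * Codes of pairs and of lists *)

Lemma code2E a b : code2 a b = CodeSeq.code [:: a; b].
Proof. by rewrite /code2 /= muln1 addnn. Qed.

Lemma code2_inj a b c d : code2 a b = code2 c d -> a = c /\ b = d.
Proof. by rewrite !code2E => /(can_inj CodeSeq.codeK) [-> ->]. Qed.

(** In binary, the code of a nonempty list is the code of its tail, a digit 1, then [a] zeros. A
    shift by at most [a] removes only zeros; a longer one removes the head and shifts the tail. *)
Lemma code_cons_div a c p :
  (2 ^ a * c.*2.+1) %/ 2 ^ p =
  if p <= a then 2 ^ (a - p) * c.*2.+1 else c %/ 2 ^ (p - a.+1).
Proof.
case: leqP => [lepa|ltap].
  by rewrite -{1}(subnK lepa) expnD mulnAC mulnK ?expn_gt0.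
have -> : 2 ^ p = 2 ^ a * 2 * 2 ^ (p - a.+1).
  by rewrite -expnSr -expnD subnKC.
by rewrite !divnMA mulKn ?expn_gt0 // divn2 /= uphalf_double.
Qed.

(** The quantifier bounds lose nothing: [e <= d <= c], and a shift with nonzero quotient satisfies
    [p < c]. *)
Lemma code_mem_unbounded n c : code_mem n c <-> exists d e,
  (d = c \/ exists p, d.*2.+1 = c %/ 2 ^ p) /\ d = 2 ^ n * e.*2.+1.
Proof.
split=> [[d [_ [sfx [e [_ ed]]]]]|[d [e [sfx ed]]]].
  rewrite addnn in ed; exists d, e; split=> //.
  case: sfx => [->|[p [_]]]; first by left.
  by move=> /quotient_pow2P; rewrite addnn; right; exists p.
have led : d <= c.
  case: sfx => [->|[p ep]] //; apply: leq_trans (leq_div c (2 ^ p)).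
  by rewrite -ep; lia.
have lee : e <= d.
  by rewrite ed; apply: leq_trans (leq_pmull _ _); [lia | rewrite expn_gt0].
exists d; rewrite ltnS; split=> //; split; last first.
  by exists e; rewrite addnn ltnS (leq_trans lee).
case: sfx => [->|[p ep]]; [by left|right; exists p; split]; last first.
  by apply/quotient_pow2P; rewrite addnn.
have : 0 < c %/ 2 ^ p by rewrite -ep.
rewrite divn_gt0 ?expn_gt0 // => lec.
by apply: leq_trans (leqnSn _); apply: leq_trans lec; apply: ltn_expl.
Qed.

Lemma pow2_odd_inj a b x y : 2 ^ a * x.*2.+1 = 2 ^ b * y.*2.+1 -> a = b.
Proof.
have log2 c z : logn 2 (2 ^ c * z.*2.+1) = c.
  rewrite lognM ?expn_gt0 // pfactorK // logn_coprime ?addn0 //.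
  by rewrite coprime2n /= odd_double.
by move/(congr1 (logn 2)); rewrite !log2.
Qed.

Lemma code_memP n s : code_mem n (CodeSeq.code s) <-> n \in s.
Proof.
elim: s => [|a s IHs].
  split=> // /code_mem_unbounded[d [e [sfx ed]]].
  have : 0 < d by rewrite ed muln_gt0 expn_gt0.
  by case: sfx => [->|[p]]; rewrite /= ?div0n.
rewrite inE; split=> [/code_mem_unbounded[d [e [sfx ed]]]|].
  case: sfx => [dc|[p]].
    by rewrite dc /= in ed; rewrite (pow2_odd_inj ed) eqxx.
  (* For [p < a] the quotient is even and cannot be [d.*2.+1]; [p = a] gives the whole tail, and
     [p > a] a suffix read inside the tail. *)
  rewrite /= code_cons_div; case: leqP => [|ltap ep].
    rewrite leq_eqVlt => /predU1P[->|ltpa].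
      rewrite subnn mul1n => -[/double_inj dc].
      by apply/orP; right; apply/IHs/code_mem_unbounded; exists d, e; split; [left|].
    move/(congr1 odd); rewrite oddM oddX /= odd_double /=.
    by rewrite subn_eq0 leqNgt ltpa.
  apply/orP; right; apply/IHs/code_mem_unbounded; exists d, e; split=> //.
  by right; exists (p - a.+1).
case/predU1P=> [->|/IHs/code_mem_unbounded[d [e [sfx ed]]]].
  apply/code_mem_unbounded; exists (CodeSeq.code (a :: s)), (CodeSeq.code s).
  by split; first left.
apply/code_mem_unbounded; exists d, e; split=> //; right.
case: sfx => [->|[p ->]].
  by exists a; rewrite /= code_cons_div leqnn subnn mul1n.
exists (p + a.+1); rewrite /= code_cons_div addnK leqNgt.
by rewrite leq_addl.
Qed.

Lemma pickle_seqE (T : countType) (s : seq T) :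
  pickle s = CodeSeq.code [seq pickle x | x <- s].
Proof. by []. Qed.

Lemma pickle_pairE (T U : countType) (p : T * U) :
  pickle p = code2 (pickle p.1) (pickle p.2).
Proof. by rewrite code2E. Qed.

Lemma pickle_inj (T : countType) : injective (@pickle T).
Proof. exact: pcan_inj pickleK. Qed.

Lemma code2_gt a b : a < code2 a b /\ b < code2 a b.
Proof.
rewrite /code2; have := ltn_expl a (isT : 1 < 2); have := ltn_expl b (isT : 1 < 2).
set x := 2 ^ a; set y := 2 ^ b => lt_b lt_a; nia.
Qed.

Lemma code_gt s n : n \in s -> n < CodeSeq.code s.
Proof.
elim: s => //= a s IHs; rewrite inE => /predU1P[->|/IHs].
  have := ltn_expl a (isT : 1 < 2); nia.
have : 0 < 2 ^ a by rewrite expn_gt0.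
nia.
Qed.

(** * Numbers as relations, triples and sets of triples *)

Section Decoding.

Variable n : nat.

Definition decode_rel z : {set 'I_n * 'I_n} :=
  [set p : 'I_n * 'I_n | `[< rel_bit n z p.1 p.2 >]].

Lemma decode_relP z (i j : 'I_n) :
  reflect (rel_bit n z i j) ((i, j) \in decode_rel z).
Proof. by rewrite inE; apply: asboolP. Qed.

Lemma decode_rel_surj X : exists2 z, z < 2 ^ (n * n) & decode_rel z = X.
Proof.
pose P k := exists i j : 'I_n, k = i * n + j /\ (i, j) \in X.
have [z ltz Hz] := bits_exist (n * n) P; exists z => //.
apply/setP=> -[i j]; apply/decode_relP/idP.
  have ltij : i * n + j < n * n by have := ltn_ord i; have := ltn_ord j; nia.
  case/(Hz _ ltij) => i' [j' [e Xij']].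
  have n_gt0 : 0 < n by apply: leq_ltn_trans (ltn_ord i).
  have ei : i = i'.
    apply: val_inj; have := congr1 (divn^~ n) e.
    by rewrite /= !divnMDl // !divn_small // !addn0.
  have ej : j = j'.
    apply: val_inj; have := congr1 (modn^~ n) e.
    by rewrite /= !modnMDl !modn_small.
  by rewrite ei ej.
move=> Xij; apply/Hz; last by exists i, j.
by have := ltn_ord i; have := ltn_ord j; nia.
Qed.

Lemma rel_eqP z (P : nat -> nat -> Prop) (X : {set 'I_n * 'I_n}) :
    (forall i j : 'I_n, P i j <-> (i, j) \in X) ->
  rel_eq n z P <-> decode_rel z = X.
Proof.
move=> HP; split=> [Hz|eX i lti j ltj].
  apply/setP=> -[i j]; apply/decode_relP/idP=> [bij|Xij].
    by apply/HP/(Hz _ (ltn_ord i) _ (ltn_ord j)).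
  by apply/(Hz _ (ltn_ord i) _ (ltn_ord j))/HP.
have HPij := HP (Ordinal lti) (Ordinal ltj); rewrite -eX in HPij.
by split=> [bij|/HPij/decode_relP//]; apply/HPij/decode_relP.
Qed.

Lemma bexists_ord (P : nat -> Prop) : bexists n P <-> exists k : 'I_n, P k.
Proof.
split=> [[k [ltk Pk]]|[k Pk]]; first by exists (Ordinal ltk).
by exists k.
Qed.

Lemma rel_compP z x y : rel_comp n z x y <->
  decode_rel z = relcomp (decode_rel x) (decode_rel y).
Proof.
apply: rel_eqP => i j; rewrite bexists_ord; split=> [[k [xik ykj]]|/relcompP[k []]].
  by apply/relcompP; exists k; split; apply/decode_relP.
by move=> /decode_relP xik /decode_relP ykj; exists k.
Qed.

Lemma rel_sharpP b' z b : rel_sharp n b' z b <->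
  decode_rel b' = relsharp (decode_rel z) (decode_rel b).
Proof.
apply: rel_eqP => i j; rewrite bexists_ord; split=> [[k [bik [zkk bkj]]]|/relsharpP[k []]].
  by apply/relsharpP; exists k; split; apply/decode_relP.
by move=> /decode_relP bik /decode_relP zkk /decode_relP bkj; exists k.
Qed.

Definition decode_triple z b r : triple 'I_n :=
  (decode_rel z, decode_rel b, decode_rel r).

Lemma decode_triple_surj (s : triple 'I_n) : exists z b r,
  [/\ z < 2 ^ (n * n), b < 2 ^ (n * n), r < 2 ^ (n * n) & decode_triple z b r = s].
Proof.
case: s => -[Z B] R.
have [z ltz dz] := decode_rel_surj Z; have [b ltb db] := decode_rel_surj B.
have [r ltr dr] := decode_rel_surj R; exists z, b, r; split=> //.
by rewrite /decode_triple dz db dr.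
Qed.

Lemma code_in_exists (C : triple 'I_n -> Prop) :
  let M := 2 ^ (n * n) in exists2 c, c < 2 ^ (M * M * M) &
  forall z b r, z < M -> b < M -> r < M ->
    (code_in n c z b r <-> C (decode_triple z b r)).
Proof.
move=> M; pose P k := C (decode_triple (k %/ M %/ M) (k %/ M %% M) (k %% M)).
have [c ltc Hc] := bits_exist (M * M * M) P; exists c => // z b r ltz ltb ltr.
have M_gt0 : 0 < M by rewrite expn_gt0.
rewrite /code_in -/M Hc; last by nia.
by rewrite /P !divnMDl // !modnMDl !(divn_small ltr) ?(modn_small ltr) addn0
  divnMDl // (divn_small ltb) addn0 modnMDl (modn_small ltb).
Qed.

End Decoding.

Section Correctness.

Variables (Sigma Gamma : finType) (N : nfa (Sigma + Gamma)) (m : nat).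
Hypothesis N_m : states_below N m.
Let t := pickle (nfa_trans N).

Lemma code_mem_transition i (a : Sigma + Gamma) j :
  code_mem (code2 (code2 i (pickle a)) j) t <-> (i, a, j) \in nfa_trans N.
Proof.
rewrite code_memP -(mem_map (@pickle_inj (nat * (Sigma + Gamma) * nat)%type)).
by rewrite !pickle_pairE.
Qed.

Lemma input_stepP a i j :
  input_step Gamma t a i j <-> (i, inl a, j) \in nfa_trans N.
Proof. exact: code_mem_transition. Qed.

Lemma output_stepP i j : output_step Sigma Gamma t i j <->
  exists b, (i, inr b, j) \in nfa_trans N.
Proof. by split=> -[b Hb]; exists b; apply/code_mem_transition. Qed.

Definition output_run (i j : nat) := exists w, run N i w j /\ proj_i w = [::].

Lemma output_run_step i j k :
  output_run i j -> output_step Sigma Gamma t j k -> output_run i k.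
Proof.
move=> [w [r pw]] /output_stepP[b tr]; exists (w ++ [:: inr b]); split.
  by apply/run_cat; exists j; split=> //; exists k.
by rewrite proj_i_cat pw.
Qed.

Lemma output_pathP i j : i < m -> j < m ->
  output_path Sigma Gamma m t i j <-> output_run i j.
Proof.
move=> lti ltj; split=> [Hij|[w [r pw]] s _ si Hs].
  (* Test the formula on the set of states reachable from [i] by output runs. *)
  have [s lts Hs] := bits_exist m (output_run i).
  apply/(Hs j ltj)/Hij => //; first by apply/Hs => //; exists [::].
  by move=> k ltk l ltl /(Hs k ltk) rk st; apply/Hs/output_run_step/st.
have [_ _ tr_m] := N_m.
elim: w i lti si r pw => [|[a|b] w IH] i lti si //=; first by move=> <-.
case=> k [tr r] pw; have ltk : k < m by apply: (tr_m _ tr).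
apply: (IH k) => //; apply: Hs lti _ ltk si _; apply/output_stepP.
by exists b.
Qed.

Lemma letter_pathP a i j : i < m -> j < m ->
  letter_path Gamma m t a i j <-> exists w, run N i w j /\ proj_i w = [:: a].
Proof.
move=> lti ltj; split=> [[k [ltk [l [ltl [p1 [st p2]]]]]]|[w [r pw]]].
  move/output_pathP: p1 => /(_ lti ltk)[w1 [r1 pw1]].
  move/output_pathP: p2 => /(_ ltl ltj)[w2 [r2 pw2]].
  exists (w1 ++ inl a :: w2); split; last by rewrite proj_i_cat pw1 /= pw2.
  apply/run_cat; exists k; split=> //; exists l; split=> //.
  exact/input_stepP.
have {}pw : proj_i w = [::] ++ [:: a] by [].
have [w1 [w2' [ew pw1 pw2]]] := proj_i_split pw; subst w.
have /run_cat[k [r1 r2]] := r; have ltk := run_below N_m lti r1.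
have [_ _ tr_m] := N_m.
(* Output letters heading the second half move to the first half until the input letter comes
   first. *)
elim: w2' w1 k ltk pw pw1 pw2 r r1 r2 => // -[c|b] w2 IH w1 k ltk pw pw1 /=.
  case=> ec pw2 r r1 [l [tr r2]]; subst c; have ltl : l < m by apply: (tr_m _ tr).
  exists k; split=> //; exists l; split=> //; split.
    by apply/output_pathP => //; exists w1.
  by split; [apply/input_stepP|apply/output_pathP => //; exists w2].
move=> pw2 r r1 [l [tr r2]]; have ltl : l < m by apply: (tr_m _ tr).
apply: (IH (w1 ++ [:: inr b]) l) => //.
- by rewrite -catA.
- by rewrite proj_i_cat pw1.
- by rewrite -catA.
by apply/run_cat; exists k; split=> //; exists l.
Qed.

(** A run of cost zero writes nothing, so the word it reads is exactly [[:: inl a]]. *)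
Lemma zero_rel_letter a (i j : 'I_m) :
  input_step Gamma t a i j <-> (i, j) \in zero_rel (cost_le N (m:=m)) [:: a].
Proof.
rewrite input_stepP; split=> [tr|/zero_relP[w [r pw]]].
  apply/zero_relP; exists [:: inl a]; split=> //=; by exists j.
rewrite leqn0 size_eq0 => /eqP ow.
have ew : w = [:: inl a].
  case: w ow pw {r} => [//|[c|//] w] /= ow [-> ].
  by case: w ow => // -[].
by rewrite ew in r; case: r => k [tr <-].
Qed.

Lemma reach_rel_letter a (i j : 'I_m) :
  letter_path Gamma m t a i j <-> (i, j) \in reach_rel (cost_le N (m:=m)) [:: a].
Proof.
rewrite letter_pathP //; split=> [[w [r pw]]|/reach_relP[k [w [r pw _]]]].
  by apply/reach_relP; exists (size (proj_o w)), w.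
by exists w.
Qed.

Lemma acceptingP r : accepting m (pickle (nfa_init N)) (pickle (nfa_final N)) r <->
  exists i f, [/\ init_state N i, final_state N f & (i, f) \in decode_rel m r].
Proof.
have memP k (s : seq nat) : code_mem k (pickle s) <-> k \in s.
  by rewrite pickle_seqE map_id code_memP.
rewrite /accepting bexists_ord; split=> [[i]|[i [f [Ii Ff /decode_relP rif]]]].
  move/bexists_ord => [f [/memP Ii [/memP Ff rif]]]; exists i, f; split=> //.
  exact/decode_relP.
by exists i; apply/bexists_ord; exists f; split; [|split] => //; apply/memP.
Qed.

Lemma stable_set_formula :
  (exists C, stable_set (cost_le N (m:=m)) C /\
     no_gap (@init_state _ _ N m) (@final_state _ _ N m) C) <->
  bexists (2 ^ (2 ^ (m * m) * 2 ^ (m * m) * 2 ^ (m * m))) (fun c =>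
    letters_formula Sigma Gamma m t c /\ product_formula m c /\
    sharp_formula m c /\
    gap_formula m (pickle (nfa_init N)) (pickle (nfa_final N)) c).
Proof.
split=> [[C [[Ca Cm Cs] gC]]|[c [ltc [fa [fm [fs fg]]]]]].
  have [c ltc Hc] := code_in_exists C; exists c; split=> //; split; [|split; [|split]].
  - move=> a z ltz r ltr /(rel_eqP z (zero_rel_letter a)) dz.
    move=> /(rel_eqP r (reach_rel_letter a)) dr.
    apply/Hc => //; have := Ca a.
    by rewrite /letter_triple -dz -dr.
  - move=> z1 l1 b1 l2 r1 l3 z2 l4 b2 l5 r2 l6 z l7 b l8 r l9.
    move=> /(Hc _ _ _ l1 l2 l3) c1 /(Hc _ _ _ l4 l5 l6) c2.
    move=> /rel_compP dz /rel_compP db /rel_compP dr; apply/Hc => //.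
    have := Cm _ _ c1 c2; rewrite /tmul /zeros /bounds /reach /=.
    by rewrite -dz -db -dr.
  - move=> z l1 b l2 r l3 b' l4 /(Hc _ _ _ l1 l2 l3) ce.
    move=> /rel_compP dz /rel_compP db /rel_compP dr /rel_sharpP db'.
    apply/Hc => //; have := Cs _ ce; rewrite /tmul /tsharp /zeros /bounds /reach /=.
    by rewrite -dz -db -dr -db'; apply.
  move=> z l1 b l2 r l3 /(Hc _ _ _ l1 l2 l3) ce /acceptingP acc.
  by apply/acceptingP; apply: gC ce acc.
(* Each triple required by the closure rules has codes by surjectivity of decoding, and the formulas
   place these codes in [c]. *)
pose C s := exists z b r, [/\ z < 2 ^ (m * m), b < 2 ^ (m * m), r < 2 ^ (m * m),
  decode_triple m z b r = s & code_in m c z b r].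
exists C; split; [split|].
- move=> a; have [z ltz dz] := decode_rel_surj (zero_rel (cost_le N (m:=m)) [:: a]).
  have [r ltr dr] := decode_rel_surj (reach_rel (cost_le N (m:=m)) [:: a]).
  exists z, r, r; split=> //; first by rewrite /decode_triple dz dr.
  apply: fa => //; first exact/(rel_eqP z (zero_rel_letter a)).
  exact/(rel_eqP r (reach_rel_letter a)).
- move=> _ _ [z1 [b1 [r1 [l1 l2 l3 <- c1]]]] [z2 [b2 [r2 [l4 l5 l6 <- c2]]]].
  set s := tmul _ _; have [z [b [r [l7 l8 l9 ds]]]] := decode_triple_surj s.
  exists z, b, r; split=> //; case: ds => dz db dr.
  by apply: (fm z1 _ b1 _ r1 _ z2 _ b2 _ r2) => //; apply/rel_compP.
- move=> _ [z [b [r [l1 l2 l3 <- c1]]]] /tmul_idempotent[/= zz bb rr].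
  have [b' l4 db'] := decode_rel_surj (relsharp (decode_rel m z) (decode_rel m b)).
  exists z, b', r; split=> //; first by rewrite /decode_triple db'.
  by apply: (fs z _ b) => //; apply/rel_compP || apply/rel_sharpP.
move=> _ [z [b [r [l1 l2 l3 <- c1]]]] /acceptingP acc.
by apply/acceptingP; apply: fg c1 acc.
Qed.

End Correctness.

Lemma pickle_nfaE (A : countType) (N : nfa A) : pickle N =
  code2 (code2 (pickle (nfa_trans N)) (pickle (nfa_init N))) (pickle (nfa_final N)).
Proof. by rewrite !pickle_pairE. Qed.

Lemma states_below_pickle (A : countType) (N : nfa A) : states_below N (pickle N).
Proof.
have lt_seq (T : countType) (s : seq T) x : x \in s -> pickle x < pickle s.
  by move=> xs; rewrite pickle_seqE; apply/code_gt/map_f.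
have [ltti ltf] := code2_gt (code2 (pickle (nfa_trans N)) (pickle (nfa_init N)))
  (pickle (nfa_final N)).
have [ltt lti] := code2_gt (pickle (nfa_trans N)) (pickle (nfa_init N)).
rewrite pickle_nfaE; split=> [q /lt_seq ltq|q /lt_seq ltq|x /lt_seq].
- exact: ltn_trans ltq (ltn_trans lti ltti).
- exact: ltn_trans ltq ltf.
rewrite pickle_pairE => ltx; have [_ ltx2] := code2_gt (pickle x.1) (pickle x.2).
exact: ltn_trans ltx2 (ltn_trans ltx (ltn_trans ltt ltti)).
Qed.

Lemma limited_formulaP (Sigma Gamma : finType) (N : nfa (Sigma + Gamma)) :
  limited_formula Sigma Gamma (pickle N) <-> has_rec_uniformization (rat_rel N).
Proof.
have N_m := states_below_pickle N.
rewrite (uniformization_iff_limited N_m) limitedP; last first.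
- exact: cost_le_split.
- exact: cost_le_cat.
- exact: cost_le_nil.
- exact: cost_le_mono.
rewrite stable_set_formula //; split=> [[t [_ [i [_ [f [_ [e H]]]]]]]|H].
  (* Injectivity of [code2] identifies [t], [i] and [f] with the codes of the components of [N]. *)
  by move: e; rewrite {1}pickle_nfaE => /code2_inj[/code2_inj[-> ->] ->].
have [ltti ltf] := code2_gt (code2 (pickle (nfa_trans N)) (pickle (nfa_init N)))
  (pickle (nfa_final N)).
have [ltt lti] := code2_gt (pickle (nfa_trans N)) (pickle (nfa_init N)).
exists (pickle (nfa_trans N)); split.
  by rewrite pickle_nfaE ltnS ltnW // (ltn_trans ltt ltti).
exists (pickle (nfa_init N)); split.
  by rewrite pickle_nfaE ltnS ltnW // (ltn_trans lti ltti).
exists (pickle (nfa_final N)); split; first by rewrite pickle_nfaE ltnS ltnW.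
by split=> //; apply: pickle_nfaE.
Qed.

Theorem mainTheorem2 (Sigma Gamma : finType) :
  @decidable_pred (nfa (Sigma + Gamma))
    (fun N => has_rec_uniformization (rat_rel N)).
Proof.
have [p Hp] := computable_limited_formula Sigma Gamma; exists p => N.
have := Hp [:: pickle N] erefl; rewrite /=; case: asboolP => /limited_formulaP.
  by move=> U e; split=> // /(_ U).
by move=> nU e; split=> // /nU.
Qed.
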